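(* Under the strong search version (not merely deciding whether the clique was planted) of the planted-clique conjecture, for every constant $c>0$ no efficient algorithm outputs, with probability $\ge n^{-c}$ over $G\sim G(n,\tfrac12,k)$, any nonzero $(k-2)$-cycle of $\mathrm{skel}_{k-2}X(G)$. Equivalently, no efficient algorithm outputs with such probability any representative of a nontrivial class in $H_{k-2}(\mathrm{skel}_{k-2}X(G))$, exact or within any $\ell_2$-distance $<\tfrac1{\sqrt k}$ of a genuine cycle. In particular, computing minimal-weight cycle representatives is average-case hard.
   Context: Graphs are simple graphs on $[n]=\{1,\dots,n\}$. $G(n,\tfrac12)$ is the Erdős–Rényi distribution (each edge present independently with probability $\tfrac12$). $G(n,\tfrac12,k)$ is obtained by drawing $G_0\sim G(n,\tfrac12)$, choosing a uniformly random $k$-subset $S\subseteq[n]$ and adding every edge inside $S$. Here $k=k(n)$ lies in the planted-clique window $(2+\varepsilon)\log_2 n\le k\le n^{1/2-\varepsilon}$ for a fixed constant $\varepsilon>0$. The clique complex $X(G)$ is the simplicial complex whose $d$-simplices are the $(d+1)$-cliques of $G$; $\mathrm{skel}_dX(G)$ keeps exactly the faces of dimension $\le d$. Chains and homology are over $\mathbb{R}$: the chain space $C_d$ has the oriented $d$-simplices as basis (orthonormal for the $\ell_2$-norm), a $d$-cycle is an element of the kernel of the boundary map $\partial_d:C_d\to C_{d-1}$, and $H_d$ is the space of $d$-cycles modulo the image of $\partial_{d+1}$. A genuine cycle is an element of $\ker\partial_{k-2}$. The weight of a cycle is the number of simplices in its support, and a minimal-weight representative of a homology class is a cycle of minimal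 weight in that class. ''Average-case hard'' refers to the input distribution $G\sim G(n,\tfrac12,k)$. An efficient algorithm is a randomized or quantum algorithm running in time $\mathrm{poly}(n)$. Strong search planted-clique conjecture (quantum version): for any constants $\alpha\in(0,\tfrac12)$ and $c>0$, any quantum polynomial-time algorithm fails to find a $k$-clique in $G\sim G(n,\tfrac12,k)$ with probability $1-n^{-c}$ (so its success probability is at most inverse polynomial), for all sufficiently large $n$ and $k\le n^{1/2-\alpha}$, with $k$ in the planted-clique window. The classical version is the same with classical randomized algorithms.
   Formalization: For outputs within ℓ2-distance < 1/√k of a genuine cycle, the output or the cycle it approximates is required to have ℓ2-norm at least 1; otherwise the zero chain, close to tiny multiples of a planted cycle, would refute the claim. *)

(* Defs.v *)
From HB Require Import structures.
From mathcomp Require Import all_boot all_order all_algebra.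
From mathcomp Require Import finmap complex.
From mathcomp Require Import boolp reals exp.

Set Implicit Arguments.
Unset Strict Implicit.
Unset Printing Implicit Defensive.

Import Order.TTheory GRing.Theory Num.Theory.
Local Open Scope ring_scope.
Local Open Scope complex_scope.

(** * Efficient algorithms

  A random-access machine with a quantum register under classical control.
  All arithmetic is addition and truncated subtraction at unit cost, so word
  lengths grow by at most one bit per step, and the machine is polynomially
  equivalent to Turing machines.  With the gates H, T, CNOT and measurement it
  is polynomially equivalent to uniform quantum circuits; without them, and
  with fair coins, it is a probabilistic machine.
  [Input], [Fetch] and [Store] address indirectly: their address, and the qubit
  index of every quantum instruction, is the content of a register.  The input
  is read-only. *)

Inductive cmd : Type :=
  | Const of nat & nat           (* r := the number c *)
  | Add of nat & nat & nat       (* r := s + t          *)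
  | Sub of nat & nat & nat       (* r := s - t          *)
  | Input of nat & nat           (* r := input[s]       *)
  | Fetch of nat & nat           (* r := mem[s]         *)
  | Store of nat & nat           (* mem[r] := s         *)
  | Coin of nat                  (* r := fair coin      *)
  | Had of nat
  | Tgate of nat
  | Cnot of nat & nat            (* control, target     *)
  | Meas of nat & nat            (* r := measured value of qubit s *)
  | Skip
  | Seq of cmd & cmd
  | If of nat & cmd & cmd        (* tests r <> 0        *)
  | While of nat & cmd.          (* tests r <> 0        *)

Fixpoint classical (c : cmd) : bool :=
  match c with
  | Had _ | Tgate _ | Cnot _ _ | Meas _ _ => false
  | Seq c1 c2 | If _ c1 c2 => classical c1 && classical c2
  | While _ c1 => classical c1
  | _ => true
  end.

(** A basis state of the (unbounded) qubit register is the finite set of qubits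
  whose value is 1; a quantum state is a finitely supported family of
  amplitudes.  States are kept unnormalized: the squared norm of the state
  attached to a computation branch is the probability of that branch. *)

Definition qstate (R : realType) :=
  {fsfun {fset nat} -> R[i] with (0 : R[i])}.

Section QState.
Variable R : realType.
Implicit Types (psi : qstate R) (A : {fset nat}) (q : nat).

Definition rsqrt2 : R := (Num.sqrt 2%:R)^-1.

Definition toggle q A : {fset nat} :=
  if q \in A then (A `\ q)%fset else (q |` A)%fset.

Definition q_init : qstate R :=
  [fsfun A in [fset (fset0 : {fset nat})]%fset => 1 | 0].

Definition q_scale (a : R[i]) psi : qstate R :=
  [fsfun A in finsupp psi => a * psi A | 0].

Definition q_had q psi : qstate R :=
  [fsfun A in (finsupp psi `|` [fset toggle q B | B in finsupp psi])%fset =>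
     rsqrt2%:C *
       (psi (A `\ q)%fset + (-1) ^+ (q \in A) * psi (q |` A)%fset) | 0].

(* the phase is exp(i pi / 4) *)
Definition q_T q psi : qstate R :=
  [fsfun A in finsupp psi =>
     if q \in A then (rsqrt2 +i* rsqrt2) * psi A else psi A | 0].

(* the gate is the identity when control and target coincide *)
Definition q_cnot q t psi : qstate R :=
  let f A := if (q != t) && (q \in A) then toggle t A else A in
  [fsfun A in [fset f B | B in finsupp psi]%fset => psi (f A) | 0].

Definition q_proj q (b : bool) psi : qstate R :=
  [fsfun A in finsupp psi => if (q \in A) == b then psi A else 0 | 0].

Definition normsq psi : R :=
  \sum_(A <- finsupp psi) (complex.Re (psi A) ^+ 2 + complex.Im (psi A) ^+ 2).

End QState.

(** [cont] is the stack of commands still to be executed. *)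
Record config (R : realType) := Config {
  cont : seq cmd;
  regs : seq nat;
  mem : seq nat;
  qst : qstate R }.

Section Semantics.
Variable R : realType.
Implicit Types (x : seq nat) (c : config R) (p : cmd) (T : nat).

Definition halted c : bool := nilp (cont c).

(** The branches after one step; a halted configuration is left unchanged. *)
Definition step x c : seq (config R) :=
  match cont c with
  | [::] => [:: c]
  | i :: K =>
    let rg r := nth 0%N (regs c) r in
    let set_reg r v psi :=
      Config K (set_nth 0%N (regs c) r v) (mem c) psi in
    let set_qst psi := Config K (regs c) (mem c) psi in
    let goto K' := Config K' (regs c) (mem c) (qst c) in
    match i with
    | Const r n => [:: set_reg r n (qst c)]
    | Add r s t => [:: set_reg r (rg s + rg t)%N (qst c)]
    | Sub r s t => [:: set_reg r (rg s - rg t)%N (qst c)]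
    | Input r s => [:: set_reg r (nth 0%N x (rg s)) (qst c)]
    | Fetch r s => [:: set_reg r (nth 0%N (mem c) (rg s)) (qst c)]
    | Store r s =>
        [:: Config K (regs c) (set_nth 0%N (mem c) (rg r) (rg s)) (qst c)]
    | Coin r =>
        [seq set_reg r (nat_of_bool b) (q_scale (rsqrt2 R)%:C (qst c))
        | b <- [:: false; true]]
    | Had q => [:: set_qst (q_had (rg q) (qst c))]
    | Tgate q => [:: set_qst (q_T (rg q) (qst c))]
    | Cnot q t => [:: set_qst (q_cnot (rg q) (rg t) (qst c))]
    | Meas r q =>
        [seq set_reg r (nat_of_bool b) (q_proj (rg q) b (qst c))
        | b <- [:: false; true]]
    | Skip => [:: goto K]
    | Seq p1 p2 => [:: goto [:: p1, p2 & K]]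
    | If r p1 p2 => [:: goto ((if rg r != 0%N then p1 else p2) :: K)]
    | While r p1 =>
        [:: goto (if rg r != 0%N then [:: p1, While r p1 & K] else K)]
    end
  end.

Fixpoint run x T c : seq (config R) :=
  if T is T'.+1 then flatten [seq run x T' c' | c' <- step x c] else [:: c].

Definition start p : config R := Config [:: p] [::] [::] (q_init R).

(** Every branch of nonzero probability halts within [T] steps. *)
Definition halts_within x T p : bool :=
  all (fun c => (normsq (qst c) == 0) || halted c) (run x T (start p)).

(** The output is the content of the memory up to the first zero cell; its
  length is therefore at most the number of steps. *)
Definition output c : seq nat := take (index 0%N (mem c)) (mem c).

Definition prob x T p (ev : pred (seq nat)) : R :=
  \sum_(c <- run x T (start p) | halted c && ev (output c)) normsq (qst c).

End Semantics.

(** * Graphs and the planted-clique distribution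

  The vertex set is ['I_n]; a simple graph is given by its set of edges. *)

Definition pairs (n : nat) : {set {set 'I_n}} := [set e : {set 'I_n} | #|e| == 2%N].

Definition clique n (E : {set {set 'I_n}}) (s : {set 'I_n}) : bool :=
  [forall u in s, forall v in s, (u != v) ==> ([set u; v] \in E)].

Definition plant n (E : {set {set 'I_n}}) (S : {set 'I_n}) : {set {set 'I_n}} :=
  E :|: [set e in pairs n | e \subset S].

Definition er_pmf (R : realType) n (p : R) (E : {set {set 'I_n}}) : R :=
  \prod_(e in pairs n) (if e \in E then p else 1 - p).

(** Expectation of [f G] for [G] drawn from G(n, 1/2, k). *)
Definition planted_expectation (R : realType) n k
    (f : {set {set 'I_n}} -> R) : R :=
  \sum_(E in powerset (pairs n)) er_pmf (2%:R^-1) E *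
    \sum_(S : {set 'I_n} | #|S| == k) 'C(n, k)%:R^-1 * f (plant E S).

Definition in_window (R : realType) (eps : R) (n k : nat) : Prop :=
  (2%:R + eps) * (ln n%:R / ln 2%:R) <= k%:R <= n%:R `^ (2%:R^-1 - eps).

(** An instance is presented as [n], [k] and the n x n adjacency matrix. *)
Definition encode n k (E : {set {set 'I_n}}) : seq nat :=
  [:: n, k & [seq nat_of_bool ([set i; j] \in E) | i <- enum 'I_n, j <- enum 'I_n]].

Inductive model := Randomized | Quantum.

Definition time_bound (d n : nat) : nat := (n ^ d + d)%N.

(** Fair coins are available in both models, so randomized algorithms are in
  particular quantum algorithms. *)
Definition efficient (R : realType) (m : model) (p : cmd) (d : nat) : Prop :=
  (m = Quantum \/ classical p) /\
  forall n k (E : {set {set 'I_n}}), (k <= n)%N -> E \subset pairs n ->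
    halts_within R (encode k E) (time_bound d n) p.

(** Probability, over G(n, 1/2, k) and the internal randomness of [p], that the
  output of [p] on [G] satisfies [ev G]. *)
Definition success_prob (R : realType) (p : cmd) (d n k : nat)
    (ev : {set {set 'I_n}} -> pred (seq nat)) : R :=
  planted_expectation k (fun G =>
    prob R (encode k G) (time_bound d n) p (ev G)).

(** In outputs, vertex [v] is written as the number [v.+1]. *)
Definition vertices_of n (w : seq nat) : {set 'I_n} :=
  [set v : 'I_n | v.+1 \in w].

Definition clique_found n k (G : {set {set 'I_n}}) : pred (seq nat) :=
  fun w => clique G (vertices_of n w) && (#|vertices_of n w| == k).

Definition strong_search_conjecture (R : realType) (m : model) : Prop :=
  forall (eps alpha c : R), 0 < eps -> 0 < alpha < 2%:R^-1 -> 0 < c ->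
  forall (p : cmd) (d : nat), efficient R m p d ->
  exists N : nat, forall n k : nat, (N <= n)%N ->
    in_window eps n k -> k%:R <= n%:R `^ (2%:R^-1 - alpha) ->
    success_prob R p d k (@clique_found n k) <= n%:R `^ (- c).

(** * Simplicial chains over the reals

  A complex is its set of nonempty faces.  A chain is the family of its
  coordinates on the simplices oriented by the increasing order of vertices. *)

Definition clique_complex n (G : {set {set 'I_n}}) : {set {set 'I_n}} :=
  [set s | (s != set0) && clique G s].

Definition skel n (d : nat) (K : {set {set 'I_n}}) : {set {set 'I_n}} :=
  [set s in K | (#|s| <= d.+1)%N].

Section Chains.
Variables (R : realType) (n : nat).
Implicit Types (K : {set {set 'I_n}}) (d : nat) (y z : {ffun {set 'I_n} -> R}).

Definition chain K d z : Prop :=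
  forall s, z s != 0 -> s \in K /\ #|s| = d.+1.

Definition boundary K z : {ffun {set 'I_n} -> R} :=
  [ffun t : {set 'I_n} => if t \in K then
     \sum_(v | v \notin t)
       (-1) ^+ #|[set u in t | (u < v)%N]| * z (v |: t)
   else 0].

Definition is_cycle K d z : Prop := chain K d z /\ boundary K z = 0.

Definition is_boundary K d z : Prop :=
  exists2 w, chain K d.+1 w & boundary K w = z.

Definition homologous K d y z : Prop := is_boundary K d (y - z).

Definition nontrivial_class K d z : Prop := is_cycle K d z /\ ~ is_boundary K d z.

Definition weight z : nat := #|[set s | z s != 0]|.

Definition minimal_weight K d z : Prop :=
  is_cycle K d z /\
  forall y, is_cycle K d y -> homologous K d y z -> (weight z <= weight y)%N.

Definition l2norm z : R := Num.sqrt (\sum_s z s ^+ 2).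

(** [y] is a representative of a nontrivial class, exactly or up to l2-error
  [< r].  The error is absolute, hence only meaningful for normalized data
  (the zero vector is arbitrarily close to small multiples of any cycle): at
  least one of [y] and the cycle it approximates has norm at least 1. *)
Definition approx_representative K d (r : R) y : Prop :=
  exists z, nontrivial_class K d z /\
    (y = z \/
     [/\ chain K d y, 1 <= Num.max (l2norm y) (l2norm z) & l2norm (y - z) < r]).

(** An output word is cut into blocks of length [k], a coefficient followed by
  the [k - 1] vertices of a simplex, and denotes the sum of these terms.  The
  coefficient refers to the increasing orientation, whatever the order in which
  the vertices are listed.
  [coef] tells how real coefficients are encoded by machine words. *)
Definition chain_of_output (coef : nat -> R) (k : nat) (w : seq nat) :
    {ffun {set 'I_n} -> R} :=
  [ffun s => \sum_(b <- reshape (nseq (size w %/ k) k) w)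
     (if vertices_of n (behead b) == s then coef (head 0%N b) else 0)].

End Chains.

(** No efficient algorithm outputs, with probability at least n^-c, a chain [y]
  such that [ev n k G y]. *)
Definition hard_on_average (R : realType) (m : model) (coef : nat -> R)
    (ev : forall n, nat -> {set {set 'I_n}} -> {ffun {set 'I_n} -> R} -> Prop) :
    Prop :=
  forall (eps c : R), 0 < eps -> 0 < c ->
  forall (p : cmd) (d : nat), efficient R m p d ->
  exists N : nat, forall n k : nat, (N <= n)%N -> in_window eps n k ->
    success_prob R p d k
      (fun (G : {set {set 'I_n}}) w => `[< ev n k G (chain_of_output n coef k w) >])
    < n%:R `^ (- c).

(* Main.v *)
Require Import Defs.
From mathcomp Require Import all_boot all_order all_algebra.
From mathcomp Require Import finmap complex boolp reals exp.
From mathcomp Require Import zify ring lra.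
Set Implicit Arguments.
Unset Strict Implicit.
Unset Printing Implicit Defensive.
Import Order.TTheory GRing.Theory Num.Theory.
Local Open Scope ring_scope.

(** Let z be a nonzero (k-2)-cycle and s a simplex in its support that does not
  extend to a k-clique.  For each u in s the boundary of z vanishes on s \ u, so
  another simplex (s \ u) + v_u of the support contains this face, and v_u is
  not adjacent to u.  Hence the v_u are distinct, and v_u lies outside the
  planted set S when u lies in S.  Put w_u = u for u outside S and w_u = v_u
  otherwise: the w_u are distinct, and the edges {w_u, u'}, one for each pair
  u, u' of vertices of s, are distinct unplanted edges.  A union bound over the
  (k-1)-tuples of pairs (w_u, u) gives such an s probability at most
  (n (k+1))^(k-1) 2^(-C(k-1,2)), which is superpolynomially small.

  Outside this event every simplex in the support of a cycle extends to a
  k-clique by one vertex.  A chain at l2-distance less than 1 from the cycle,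
  one of the two having norm at least 1, shares a simplex with its support.
  Therefore a program that tries to extend each simplex of the output by each
  vertex finds a k-clique. *)

(** * Total probability *)

Section QuantumNorm.
Variable R : realType.
Implicit Types (psi : qstate R) (A B : {fset nat}) (q : nat) (z : R[i]).

Definition csq z : R := complex.Re z ^+ 2 + complex.Im z ^+ 2.

Lemma csq_ge0 z : 0 <= csq z.
Proof. by rewrite addr_ge0 ?sqr_ge0. Qed.

Lemma csq0 : csq 0 = 0.
Proof. by rewrite /csq /= expr0n addr0. Qed.

Lemma rsqrt2_sqr : rsqrt2 R ^+ 2 = 2%:R^-1.
Proof. by rewrite exprVn sqr_sqrtr ?ler0n. Qed.

Lemma csq_real (a : R) z : csq (a%:C * z)%C = a ^+ 2 * csq z.
Proof. by case: z => x y; rewrite /csq /=; ring. Qed.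

Lemma csq_phase z : csq ((rsqrt2 R +i* rsqrt2 R)%C * z) = csq z.
Proof.
case: z => x y; rewrite /csq /=.
rewrite [LHS](_ : _ = 2%:R * rsqrt2 R ^+ 2 * (x ^+ 2 + y ^+ 2)); last by ring.
by rewrite rsqrt2_sqr mulfV ?mul1r ?pnatr_eq0.
Qed.

Lemma csq_parallelogram z w : csq (z + w) + csq (z - w) = 2%:R * (csq z + csq w).
Proof. by case: z w => a b [c d]; rewrite /csq /=; ring. Qed.

Lemma normsq_ge0 psi : 0 <= normsq psi.
Proof. by apply: sumr_ge0 => A _; apply: csq_ge0. Qed.

(** States with different supports are compared by summing over one common finite set; amplitudes
    off the support contribute 0. *)
Lemma normsq_incl (D : {fset {fset nat}}) psi :
  {subset finsupp psi <= D} -> normsq psi = \sum_(A <- D) csq (psi A).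
Proof.
move=> sub; apply: big_fset_incl; first by apply/fsubsetP.
by move=> A _; rewrite memNfinsupp => /eqP ->; apply: csq0.
Qed.

Lemma toggleK q : involutive (toggle q).
Proof.
rewrite /toggle => A; case: (boolP (q \in A)) => qA.
  by rewrite !inE eqxx /= fsetD1K.
by rewrite !inE eqxx /= fsetU1K.
Qed.

Lemma sum_involution (D : {fset {fset nat}}) (h : {fset nat} -> {fset nat})
    (F : {fset nat} -> R) :
  involutive h -> {homo h : A / A \in D} ->
  \sum_(A <- D) F (h A) = \sum_(A <- D) F A.
Proof.
move=> hK hD; rewrite -(big_map h xpredT F); apply: perm_big; apply: uniq_perm.
- by rewrite map_inj_uniq ?fset_uniq //; apply: inv_inj.
- exact: fset_uniq.
move=> A; apply/mapP/idP => [[B BD ->]|AD]; first exact: hD.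
by exists (h A); [exact: hD | rewrite hK].
Qed.

Lemma q_scaleE a psi A : q_scale a psi A = a * psi A.
Proof.
rewrite fsfun_fun; case: ifPn => //.
by rewrite memNfinsupp => /eqP ->; rewrite mulr0.
Qed.

Lemma q_TE q psi A :
  q_T q psi A = if q \in A then (rsqrt2 R +i* rsqrt2 R)%C * psi A else psi A.
Proof.
rewrite fsfun_fun; case: ifPn => //.
by rewrite memNfinsupp => /eqP ->; rewrite mulr0 if_same.
Qed.

Lemma q_projE q b psi A :
  q_proj q b psi A = if (q \in A) == b then psi A else 0.
Proof.
rewrite fsfun_fun; case: ifPn => //.
by rewrite memNfinsupp => /eqP ->; rewrite if_same.
Qed.

Definition cnot_map q t A := if (q != t) && (q \in A) then toggle t A else A.

Lemma in_toggle q t A : q != t -> (q \in toggle t A) = (q \in A).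
Proof. by rewrite /toggle => /negbTE qt; case: ifP => _; rewrite !inE qt. Qed.

Lemma cnot_mapK q t : involutive (cnot_map q t).
Proof.
move=> A; rewrite /cnot_map; case: (boolP (q != t)) => //= qt.
by case: (boolP (q \in A)) => qA; rewrite ?in_toggle // ?qA ?toggleK // (negbTE qA).
Qed.

Lemma q_cnotE q t psi A : q_cnot q t psi A = psi (cnot_map q t A).
Proof.
rewrite fsfun_fun; case: ifPn => // Anot; apply/esym/eqP.
rewrite -memNfinsupp; apply: contra Anot => supp; apply/imfsetP.
by exists (cnot_map q t A) => //; rewrite -/(cnot_map q t _) cnot_mapK.
Qed.

(** The two sets on the right are A and [toggle q A] in some order. Off the domain of the [fsfun]
    neither is in the support, so both sides vanish. *)
Lemma q_hadE q psi A :
  q_had q psi A = (rsqrt2 R)%:C%C *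
    (psi (A `\ q)%fset + (-1) ^+ (q \in A) * psi (q |` A)%fset).
Proof.
rewrite fsfun_fun; case: ifPn => //; rewrite inE negb_or => /andP[].
rewrite memNfinsupp => /eqP A0 Bnot.
have /eqP B0 : psi (toggle q A) == 0.
  rewrite -memNfinsupp; apply: contra Bnot => supp; apply/imfsetP.
  by exists (toggle q A) => //; rewrite toggleK.
suff [-> ->] : psi (A `\ q)%fset = 0 /\ psi (q |` A)%fset = 0.
  by rewrite mulr0 addr0 mulr0.
move: B0; rewrite /toggle; case: ifP => qA B0; split => //.
  by rewrite mem_fset1U.
by rewrite mem_fsetD1 // qA.
Qed.

Lemma normsq_scale (a : R) psi : normsq (q_scale a%:C%C psi) = a ^+ 2 * normsq psi.
Proof.
rewrite (@normsq_incl (finsupp psi)) => [|A].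
  by rewrite /normsq mulr_sumr; apply: eq_bigr => A _; rewrite q_scaleE csq_real.
by rewrite !mem_finsupp q_scaleE; apply: contraNN => /eqP ->; rewrite mulr0.
Qed.

Lemma normsq_T q psi : normsq (q_T q psi) = normsq psi.
Proof.
rewrite (@normsq_incl (finsupp psi)) => [|A].
  by apply: eq_bigr => A _; rewrite q_TE -/(csq _); case: ifP; rewrite ?csq_phase.
by rewrite !mem_finsupp q_TE; apply: contraNN => /eqP ->; rewrite mulr0 if_same.
Qed.

Lemma normsq_proj q psi :
  normsq (q_proj q false psi) + normsq (q_proj q true psi) = normsq psi.
Proof.
have sub b : {subset finsupp (q_proj q b psi) <= finsupp psi}.
  by move=> A; rewrite !mem_finsupp q_projE; apply: contraNN => /eqP ->; rewrite if_same.
rewrite !(normsq_incl (sub _)) -big_split; apply: eq_bigr => A _.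
by rewrite /= !q_projE -/(csq _); case: (q \in A); rewrite /= csq0 ?add0r ?addr0.
Qed.

Lemma normsq_cnot q t psi : normsq (q_cnot q t psi) = normsq psi.
Proof.
pose h := cnot_map q t.
(* Adding the image makes the index set invariant under the involution, so the sum can be
   reindexed. *)
pose D := (finsupp psi `|` [fset h B | B in finsupp psi])%fset.
have subD : {subset finsupp psi <= D} by move=> A; rewrite inE => ->.
have hD : {homo h : A / A \in D}.
  move=> A; rewrite !inE => /orP[AS|/imfsetP[B BS ->]].
    by apply/orP; right; apply/imfsetP; exists A.
  by rewrite [h (h B)]cnot_mapK BS.
rewrite (normsq_incl subD) (@normsq_incl D) => [|A].
  rewrite -[RHS](sum_involution _ (@cnot_mapK q t) hD).
  by apply: eq_bigr => A _; rewrite q_cnotE.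
rewrite mem_finsupp q_cnotE -mem_finsupp => /subD /hD.
by rewrite /h cnot_mapK.
Qed.

(** The gate mixes only the amplitudes at A and [toggle q A]; with the factor 1/2 from [rsqrt2_sqr]
    this is the parallelogram law. *)
Lemma csq_had_pair q psi A :
  csq (q_had q psi A) + csq (q_had q psi (toggle q A)) =
  csq (psi A) + csq (psi (toggle q A)).
Proof.
wlog qA : A / q \notin A.
  move=> W; case: (boolP (q \in A)) => qA; last exact: W.
  have := W (toggle q A); rewrite toggleK addrC => -> //; first by rewrite addrC.
  by rewrite /toggle qA !inE eqxx.
have -> : toggle q A = (q |` A)%fset by rewrite /toggle (negbTE qA).
rewrite !q_hadE (negbTE qA) fsetU1K // mem_fsetD1 // !inE eqxx /= fsetUA fsetUid.
rewrite !csq_real -mulrDr expr0 mul1r expr1 mulN1r csq_parallelogram mulrA.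
by rewrite rsqrt2_sqr mulVf ?mul1r ?pnatr_eq0.
Qed.

Lemma normsq_had q psi : normsq (q_had q psi) = normsq psi.
Proof.
pose D := (finsupp psi `|` [fset toggle q B | B in finsupp psi])%fset.
have hD : {homo toggle q : A / A \in D}.
  move=> A; rewrite !inE => /orP[AS|/imfsetP[B BS ->]].
    by apply/orP; right; apply/imfsetP; exists A.
  by rewrite toggleK BS.
have subD : {subset finsupp psi <= D} by move=> A; rewrite inE => ->.
rewrite (normsq_incl subD) (@normsq_incl D); last first.
  by move=> A; rewrite mem_finsupp fsfun_fun; case: ifP => //; rewrite eqxx.
(* Doubling pairs each A with [toggle q A] and reduces the claim to the pairwise identity. *)
apply: (@mulfI _ 2%:R); first by rewrite pnatr_eq0.
rewrite !mulr_natl !mulr2n -{2}(sum_involution _ (@toggleK q) hD).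
rewrite -[X in _ = _ + X](sum_involution _ (@toggleK q) hD) -!big_split.
by apply: eq_bigr => A _; apply: csq_had_pair.
Qed.

Lemma normsq_init : normsq (q_init R) = 1.
Proof.
rewrite (@normsq_incl [fset fset0]%fset) => [|A].
  by rewrite big_seq_fset1 fsfun_fun inE eqxx /csq /= expr1n expr0n addr0.
by rewrite mem_finsupp fsfun_fun; case: ifP => // _; rewrite eqxx.
Qed.

(** Gates are unitary, a measurement splits the state by complementary projections, and a coin makes
    two copies of half the weight. *)
Lemma normsq_step x (c : config R) :
  \sum_(c' <- step x c) normsq (qst c') = normsq (qst c).
Proof.
case: c => [[|i K] r M psi]; first by rewrite big_seq1.
case: i => [??|???|???|??|??|??|?|?|?|??|??||??|???|??]; rewrite /step /= ?big_seq1 //=.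
- rewrite !big_cons big_nil addr0 /= !normsq_scale rsqrt2_sqr -mulrDl.
  by rewrite [_ + _](_ : _ = 1) ?mul1r //; field.
- exact: normsq_had.
- exact: normsq_T.
- exact: normsq_cnot.
- by rewrite !big_cons big_nil addr0 /= normsq_proj.
Qed.

Lemma normsq_run x T (c : config R) :
  \sum_(c' <- run x T c) normsq (qst c') = normsq (qst c).
Proof.
elim: T c => [|T IH] c /=; first by rewrite big_seq1.
rewrite big_flatten big_map -[RHS](normsq_step x c).
by apply: eq_bigr => c' _; apply: IH.
Qed.

Lemma prob_le1 x T p ev : prob R x T p ev <= 1.
Proof.
rewrite -normsq_init -(normsq_run x T (start R p)) /prob big_mkcond.
by apply: ler_sum => c _; case: ifP => // _; apply: normsq_ge0.
Qed.

Lemma prob_mono x T p (ev ev' : pred (seq nat)) :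
  (forall w, ev w -> ev' w) -> prob R x T p ev <= prob R x T p ev'.
Proof.
move=> sub; rewrite /prob big_mkcond [leRHS]big_mkcond; apply: ler_sum => c _.
case: (halted c) => //=; case: ifP => evc; last by case: ifP; rewrite ?normsq_ge0.
by rewrite (sub _ evc).
Qed.

(** [halts_within] exempts branches of weight 0. Their descendants have nonnegative weights summing
    to 0, so they are exempt too. *)
Lemma run_norm0 x T (c : config R) :
  normsq (qst c) = 0 -> all (fun c' => normsq (qst c') == 0) (run x T c).
Proof.
rewrite -(normsq_run x T c); elim: (run x T c) => // c' s IH.
rewrite big_cons => /eqP; rewrite paddr_eq0 ?normsq_ge0 ?sumr_ge0 //.
  by case/andP=> /= -> /eqP; apply: IH.
by move=> ? _; apply: normsq_ge0.
Qed.

End QuantumNorm.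

(** * Running programs in sequence *)

Local Open Scope nat_scope.

Section Sequencing.
Variables (R : realType) (x : seq nat).
Implicit Types (c : config R) (K : seq cmd).

Lemma run_halted T c : halted c -> run x T c = [:: c].
Proof. by case: c => [[|]] // r M psi _; elim: T => //= T ->. Qed.

Lemma run_add a b c : run x (a + b) c = flatten [seq run x b c' | c' <- run x a c].
Proof.
elim: a c => [|a IH] c /=; first by rewrite cats0.
elim: (step x c) => //= c' s IHs.
by rewrite IH IHs map_cat flatten_cat.
Qed.

Definition push K c := Config (cont c ++ K) (regs c) (Defs.mem c) (qst c).

Lemma step_push K c :
  ~~ halted c -> step x (push K c) = [seq push K c' | c' <- step x c].
Proof.
case: c => [[|i K0] r M psi] // _.
by case: i => // s p1 *; rewrite /step /push /=; case: ifP.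
Qed.

(* Addresses may be exponentially large in the running time, but a step writes at
  most one cell, so this count bounds the length of the output by the time. *)
Definition live (M : seq nat) := count (fun v => v != 0) M.

Lemma live_set M i v : live (set_nth 0 M i v) <= (live M).+1.
Proof.
elim: M i => [|a M IH] [|i] /=; rewrite ?addn0.
- by case: (v != 0).
- by rewrite add0n; elim: i => //=; case: (v != 0).
- by case: (v != 0); case: (a != 0) => /=; lia.
- by move: (IH i); rewrite /live; lia.
Qed.

Lemma live_step c c' : List.In c' (step x c) -> live (Defs.mem c') <= (live (Defs.mem c)).+1.
Proof.
case: c => [[|i K0] r M psi] /=; first by case=> // <-.
by case: i => /= *; intuition; subst => //=; rewrite ?live_set.
Qed.

(** The program is deterministic and returns the quantum state unchanged: t, r' and M' are chosen
    before [psi]. Hence branch probabilities carry over. *)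
Definition output_spec (B Q : nat) (q : cmd) (ev ev' : pred (seq nat)) :=
  forall r M, live M <= B -> exists t r' M', [/\ t <= Q,
    forall psi : qstate R,
      run x t (Config [:: q] r M psi) = [:: Config [::] r' M' psi] &
    ev (take (index 0 M) M) -> ev' (take (index 0 M') M')].

Section Append.
Variables (B Q : nat) (q : cmd) (ev ev' : pred (seq nat)).
Hypothesis qspec : output_spec B Q q ev ev'.

Lemma run_push_halted c T : halted c -> live (Defs.mem c) <= B -> Q <= T ->
  exists c', [/\ run x T (push [:: q] c) = [:: c'], halted c', qst c' = qst c
    & ev (output c) -> ev' (output c')].
Proof.
case: c => [[|]] // r M psi _ /= liveM QT.
have [t [r' [M' [tQ qrun evM]]]] := qspec r liveM.
exists (Config [::] r' M' psi); split => //.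
rewrite -(subnKC (leq_trans tQ QT)) run_add /push /= qrun /= cats0.
exact: run_halted.
Qed.

(** Each step writes at most one new nonzero cell and uses one unit of time, so the bound on [live]
    plus remaining time is inherited. *)
Lemma halts_push T c : live (Defs.mem c) + T <= B ->
  all (fun c => (normsq (qst c) == 0%R) || halted c) (run x T c) ->
  all (fun c => (normsq (qst c) == 0%R) || halted c) (run x (T + Q) (push [:: q] c)).
Proof.
elim: T c => [|T IH] c /= liveB.
  rewrite andbT => /orP[/eqP c0|hc].
    by apply: sub_all (@run_norm0 R x Q (push [:: q] c) c0) => c' ->.
  rewrite addn0 in liveB.
  have [c' [-> hc' _ _]] := run_push_halted hc liveB (leqnn Q).
  by rewrite /= hc' orbT.
case: (boolP (halted c)) => hc.
  have [c' [E hc' _ _]] := run_push_halted hc (leq_trans (leq_addr _ _) liveB) (leq_addl T.+1 Q).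
  by move: E; rewrite /= => ->; rewrite /= hc' orbT.
rewrite step_push // -map_comp.
have: forall c', List.In c' (step x c) -> live (Defs.mem c') + T <= B.
  move=> c' /live_step le; apply: leq_trans liveB.
  by rewrite -addSnnS leq_add2r.
elim: (step x c) => //= c' s IHs liveS.
rewrite !all_cat => /andP[run1 run2]; apply/andP; split.
  by apply: IH => //; apply: liveS; left.
by apply: IHs => // c'' sc''; apply: liveS; right.
Qed.

(** Each accepting halted branch of the first run continues to one accepting branch of the same
    weight; other branches add nonnegative terms. *)
Lemma weight_push T c : live (Defs.mem c) + T <= B ->
  (\sum_(c' <- run x T c | halted c' && ev (output c')) normsq (qst c') <=
   \sum_(c' <- run x (T + Q) (push [:: q] c) | halted c' && ev' (output c'))
     normsq (qst c'))%R.
Proof.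
have halted_case S c0 : halted c0 -> live (Defs.mem c0) <= B -> Q <= S ->
  (\sum_(c' <- [:: c0] | halted c' && ev (output c')) normsq (qst c') <=
   \sum_(c' <- run x S (push [:: q] c0) | halted c' && ev' (output c'))
     normsq (qst c'))%R.
  move=> hc liveB QS; have [c' [-> hc' eqq imp]] := run_push_halted hc liveB QS.
  rewrite big_mkcond [leRHS]big_mkcond !big_seq1 hc hc' eqq /=.
  case: (boolP (ev _)) => [/imp -> //|_].
  by case: ifP => // _; apply: normsq_ge0.
elim: T c => [|T IH] c liveB.
  rewrite addn0 in liveB; case: (boolP (halted c)) => hc; first exact: halted_case.
  rewrite [leLHS]big_mkcond big_seq1 (negbTE hc) /=.
  by apply: sumr_ge0 => ? _; apply: normsq_ge0.
case: (boolP (halted c)) => hc.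
  rewrite run_halted //; apply: halted_case => //; last exact: leq_addl.
  by apply: leq_trans liveB; apply: leq_addr.
rewrite /= step_push // -map_comp.
have: forall c', List.In c' (step x c) -> live (Defs.mem c') + T <= B.
  move=> c' /live_step le; apply: leq_trans liveB.
  by rewrite -addSnnS leq_add2r.
elim: (step x c) => [|c' s IHs] liveS /=; first by rewrite !big_nil.
rewrite !big_cat /= lerD //; first by apply: IH; apply: liveS; left.
by apply: IHs => // c'' sc''; apply: liveS; right.
Qed.

Lemma halts_within_seq p : halts_within R x B p ->
  halts_within R x (B + Q).+1 (Seq p q).
Proof.
move=> hp; rewrite /halts_within /= cats0.
by apply: (halts_push (c := start R p)).
Qed.

Lemma prob_seq p :
  (prob R x B p ev <= prob R x (B + Q).+1 (Seq p q) ev')%R.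
Proof.
rewrite /prob /= cats0.
by apply: (weight_push (c := start R p)).
Qed.

End Append.

End Sequencing.

(** * Hoare triples with time bounds *)

Section ProgramLogic.
Variables (R : realType) (x : seq nat).
Implicit Types (p q : cmd) (r M : seq nat) (Q : seq nat -> seq nat -> Prop).

Lemma runS T (c : config R) :
  run x T.+1 c = flatten [seq run x T c' | c' <- step x c].
Proof. by []. Qed.

(** A total-correctness triple for a deterministic program. Its outcome depends neither on the stack
    K nor on [psi], which makes triples compose. *)
Definition sat p T r M Q := exists t r' M', [/\ t <= T,
  forall K (psi : qstate R),
    run x t (Config (p :: K) r M psi) = [:: Config K r' M' psi] & Q r' M'].

Lemma sat_weaken p T T' r M Q Q' : T <= T' -> (forall r' M', Q r' M' -> Q' r' M') ->
  sat p T r M Q -> sat p T' r M Q'.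
Proof.
move=> TT QQ [t [r' [M' [tT E q]]]]; exists t, r', M'; split => //.
  exact: leq_trans TT.
exact: QQ.
Qed.

Lemma sat_step p q T r M Q :
  (forall K (psi : qstate R),
     step x (Config (p :: K) r M psi) = [:: Config (q :: K) r M psi]) ->
  sat q T r M Q -> sat p T.+1 r M Q.
Proof.
move=> st [t [r' [M' [tT E H]]]]; exists t.+1, r', M'; split => // K psi.
by rewrite runS st /= cats0 E.
Qed.

Lemma sat_seq p q T1 T2 r M Q :
  sat p T1 r M (fun r' M' => sat q T2 r' M' Q) ->
  sat (Seq p q) (T1 + T2).+1 r M Q.
Proof.
move=> [t1 [r1 [M1 [le1 E1 [t2 [r2 [M2 [le2 E2 H]]]]]]]].
exists (t1 + t2).+1, r2, M2; split => // [|K psi].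
  by rewrite ltnS leq_add.
by rewrite /= cats0 run_add E1 /= cats0 E2.
Qed.

Lemma sat_const a v r M Q : Q (set_nth 0 r a v) M -> sat (Const a v) 1 r M Q.
Proof. by move=> H; exists 1, (set_nth 0 r a v), M. Qed.

Lemma sat_add a b c r M Q :
  Q (set_nth 0 r a (nth 0 r b + nth 0 r c)) M -> sat (Add a b c) 1 r M Q.
Proof. by move=> H; exists 1, (set_nth 0 r a (nth 0 r b + nth 0 r c)), M. Qed.

Lemma sat_sub a b c r M Q :
  Q (set_nth 0 r a (nth 0 r b - nth 0 r c)) M -> sat (Defs.Sub a b c) 1 r M Q.
Proof. by move=> H; exists 1, (set_nth 0 r a (nth 0 r b - nth 0 r c)), M. Qed.

Lemma sat_input a b r M Q :
  Q (set_nth 0 r a (nth 0 x (nth 0 r b))) M -> sat (Input a b) 1 r M Q.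
Proof. by move=> H; exists 1, (set_nth 0 r a (nth 0 x (nth 0 r b))), M. Qed.

Lemma sat_fetch a b r M Q :
  Q (set_nth 0 r a (nth 0 M (nth 0 r b))) M -> sat (Fetch a b) 1 r M Q.
Proof. by move=> H; exists 1, (set_nth 0 r a (nth 0 M (nth 0 r b))), M. Qed.

Lemma sat_store a b r M Q :
  Q r (set_nth 0 M (nth 0 r a) (nth 0 r b)) -> sat (Store a b) 1 r M Q.
Proof. by move=> H; exists 1, r, (set_nth 0 M (nth 0 r a) (nth 0 r b)). Qed.

Lemma sat_skip r M Q : Q r M -> sat Skip 1 r M Q.
Proof. by move=> H; exists 1, r, M. Qed.

Lemma sat_if a p q T r M Q :
  (nth 0 r a != 0 -> sat p T r M Q) -> (nth 0 r a = 0 -> sat q T r M Q) ->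
  sat (If a p q) T.+1 r M Q.
Proof.
move=> Hp Hq; case: (boolP (nth 0 r a != 0)) => [ra|/negPn/eqP ra].
  by apply: sat_step (Hp ra) => K psi; rewrite /step /= ra.
by apply: sat_step (Hq ra) => K psi; rewrite /step /= ra.
Qed.

(** [P j] is the invariant with j rounds left. A round costs one test and the body; the last unit is
    the failing test. *)
Lemma sat_while a p T n r M (P : nat -> seq nat -> seq nat -> Prop) :
  (forall j r M, P j.+1 r M -> nth 0 r a <> 0 /\ sat p T r M (P j)) ->
  (forall r M, P 0 r M -> nth 0 r a = 0) ->
  P n r M -> sat (While a p) (n * T.+1 + 1) r M (P 0).
Proof.
move=> body exit; elim: n r M => [|n IH] r M Pn.
  by exists 1, r, M; split => // K psi; rewrite /= (exit _ _ Pn).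
have [/eqP ra [t1 [r1 [M1 [le1 E1 /IH]]]]] := body _ _ _ Pn.
move=> [t2 [r2 [M2 [le2 E2 H]]]]; exists (t1 + t2).+1, r2, M2; split => // [|K psi].
  by move: le1 le2; rewrite mulSn; lia.
by rewrite runS /step /= ra /= cats0 run_add E1 /= cats0 E2.
Qed.

(* Register [one] must hold 1; the loop condition lives in register [t]. *)
Definition for_loop one i hi t p :=
  Seq (Const i 0) (Seq (Defs.Sub t hi i)
    (While t (Seq p (Seq (Add i i one) (Defs.Sub t hi i))))).

Lemma sat_for one i hi t p T n r M (P : nat -> seq nat -> seq nat -> Prop) :
  uniq [:: one; i; hi; t] ->
  (forall j r M u v, P j r M -> P j (set_nth 0 (set_nth 0 r i u) t v) M) ->
  (forall j r M, j < n -> nth 0 r one = 1 -> nth 0 r i = j -> nth 0 r hi = n ->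
     P j r M -> sat p T r M (fun r' M' =>
       [/\ nth 0 r' one = 1, nth 0 r' i = j, nth 0 r' hi = n & P j.+1 r' M'])) ->
  nth 0 r one = 1 -> nth 0 r hi = n -> P 0 r M ->
  sat (for_loop one i hi t p) (n * (T + 5) + 5) r M (fun r' M' =>
    [/\ nth 0 r' one = 1, nth 0 r' hi = n & P n r' M']).
Proof.
rewrite /= !inE !negb_or !andbT => /and3P[/and3P[o_i o_h o_t] /andP[i_h i_t] h_t].
move=> stable body r_one r_hi P0.
(* With m rounds left the counter stands at n - m, and [t], recomputed as [hi - i], equals m. *)
pose I m r M := [/\ nth 0 r one = 1, nth 0 r i = n - m & nth 0 r hi = n] /\
   [/\ nth 0 r t = m, m <= n & P (n - m) r M].
apply: (@sat_weaken _ (1 + (1 + (n * (T + (1 + 1).+1).+2 + 1)).+1).+1 _ _ _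
  (fun r' M' => I 0 r' M')).
- lia.
- by move=> r1 M1 [[? _ ?] [_ _]]; rewrite subn0.
apply: sat_seq; apply: sat_const; apply: sat_seq; apply: sat_sub.
rewrite !nth_set_nth /= eqxx.
have -> : (hi == i) = false by rewrite eq_sym (negbTE i_h).
rewrite r_hi subn0.
apply: (@sat_while _ _ _ n).
- move=> j r1 M1 [[one1 i1 hi1] [t1 le_jn Pj]]; split; first by rewrite t1.
  apply: sat_seq; apply: sat_weaken (body _ _ _ _ one1 i1 hi1 Pj) => // [r2 M2|]; last lia.
  move=> [one2 i2 hi2 P2]; apply: sat_seq; apply: sat_add; apply: sat_sub.
  rewrite /I; have -> : n - j = (n - j.+1).+1 by lia.
  split; split; last exact: stable.
  + by rewrite !nth_set_nth /= (negbTE o_t) nth_set_nth /= (negbTE o_i).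
  + rewrite !nth_set_nth /= (negbTE i_t) nth_set_nth /= eqxx i2 one2; lia.
  + by rewrite !nth_set_nth /= (negbTE h_t) nth_set_nth /= eq_sym (negbTE i_h).
  + rewrite !nth_set_nth /= eqxx ?nth_set_nth /= eqxx eq_sym (negbTE i_h) hi2 i2 one2; lia.
  + exact: ltnW.
- by move=> r1 M1 [_ []].
split; split; rewrite ?subnn //; last exact: stable.
- by rewrite !nth_set_nth /= (negbTE o_t) nth_set_nth /= (negbTE o_i).
- by rewrite !nth_set_nth /= (negbTE i_t) nth_set_nth /= eqxx.
- by rewrite !nth_set_nth /= (negbTE h_t) nth_set_nth /= eq_sym (negbTE i_h).
- by rewrite !nth_set_nth /= eqxx.
Qed.

End ProgramLogic.

(** * The clique search program *)

Local Notation "p ;; q" := (Seq p q) (at level 62, right associativity).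

(* Registers: 0 and 1 hold these constants, 2 holds n, 3 holds k, 4 the position
  s of a window of k cells, 5 the saved content of cell s, 6 the vertex tried in
  that cell, 7 the score, which is 0 for a clique, 8 and 9 the last successful
  position and vertex, 10 and 11 the offsets a and b, 12 the offset of a row of
  the adjacency matrix. *)
Definition scan_row : cmd :=
  for_loop 1 11 10 19
    (Add 15 4 11 ;; Fetch 14 15 ;; Add 15 12 14 ;; Add 15 15 1 ;;
     Defs.Sub 15 15 2 ;; Defs.Input 15 15 ;; Defs.Sub 15 1 15 ;; Add 7 7 15).

(* The machine has no multiplication; capping the content of the cell at n
  keeps the running time polynomial. *)
Definition row_offset : cmd := Const 12 0 ;; for_loop 1 20 22 21 (Add 12 12 2).

(** For cell content y, the truncated difference [y - (y - n)] puts the minimum of y and n in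
    register 22. *)
Definition check_cell : cmd :=
  Add 15 4 10 ;; Fetch 13 15 ;; Defs.Sub 15 13 2 ;; Add 7 7 15 ;;
  Defs.Sub 22 13 15 ;; Defs.Sub 15 1 13 ;; Add 7 7 15 ;; row_offset ;; scan_row.

Definition check_window : cmd := Const 7 0 ;; for_loop 1 10 3 18 check_cell.

(** Branching tests for a nonzero register, so score 0 is recognised by [1 - score]. *)
Definition try_vertex : cmd :=
  Add 6 23 1 ;; Store 4 6 ;; check_window ;; Defs.Sub 15 1 7 ;;
  If 15 (Add 8 4 0 ;; Add 9 6 0) Skip.

Definition try_position : cmd :=
  for_loop 1 23 2 17 try_vertex ;; Store 4 5 ;; Add 4 4 1 ;; Fetch 5 4.

(** The final zero ends the output. *)
Definition copy_window : cmd :=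
  Store 8 9 ;; for_loop 1 10 3 18 (Add 15 8 10 ;; Fetch 14 15 ;; Store 10 14) ;;
  Store 3 0.

Definition extract_clique : cmd :=
  Const 0 0 ;; Const 1 1 ;; Defs.Input 2 0 ;; Defs.Input 3 1 ;; Const 8 0 ;;
  Const 9 0 ;; Const 4 0 ;; Fetch 5 4 ;; While 5 try_position ;; copy_window.

Lemma get_set r i v j : nth 0 (set_nth 0 r i v) j = if j == i then v else nth 0 r j.
Proof. by rewrite nth_set_nth. Qed.

Definition frame (W : seq nat) (r0 r : seq nat) :=
  forall i, i \notin W -> nth 0 r i = nth 0 r0 i.

Lemma frame_set W r0 r i v : i \in W -> frame W r0 r -> frame W r0 (set_nth 0 r i v).
Proof.
move=> iW fr j jW; rewrite get_set /=; case: eqP => [ji|_]; last exact: fr.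
by rewrite ji iW in jW.
Qed.

Lemma frame_trans W W' r0 r1 r2 : {subset W <= W'} -> frame W r1 r2 ->
  frame W' r0 r1 -> frame W' r0 r2.
Proof. by move=> sub f12 f01 i iW; rewrite f12 ?f01 //; apply: contra iW => /sub. Qed.

(** Memories are compared as functions through [nth 0], which hides the padding done by
    [set_nth]. *)
Definition upd (m : nat -> nat) i v j := if j == i then v else m j.

Lemma nth_upd M i v : nth 0 (set_nth 0 M i v) = upd (nth 0 M) i v.
Proof. by apply/funext => j; rewrite get_set. Qed.

Lemma upd_upd m i v w : upd (upd m i v) i w = upd m i w.
Proof. by apply/funext => j; rewrite /upd; case: eqP. Qed.

Lemma upd_id m i : upd m i (m i) = m.
Proof. by apply/funext => j; rewrite /upd; case: eqP => // ->. Qed.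

(** * Specification of the search program *)

Section WindowSearch.
Variables (R : realType) (x : seq nat) (n k : nat).
Implicit Types (r M : seq nat) (m : nat -> nat).
Local Notation sat := (@sat R x).

(** A term is 1 for a missing edge. For vertices written u = i+1 and v = j+1 and [row] = un, the
    index un + v + 1 - n is in + j + 2, the place of entry (i, j) behind the leading cells n and
    k. *)
Definition row_score row m s a :=
  \sum_(b < a) (1 - nth 0 x (row + m (s + b) + 1 - n)).

(** The first two terms vanish exactly when the cell names a vertex; then the third vanishes when
    this vertex is joined to all earlier ones of the window. *)
Definition cell_score m s a :=
  (m (s + a) - n) + (1 - m (s + a)) + row_score (minn (m (s + a)) n * n) m s a.

Definition score m s := \sum_(a < k) cell_score m s a.

Lemma sat_seq1 p q T r M Q :
  sat p 1 r M (fun r' M' => sat q T r' M' Q) -> sat (p ;; q) T.+2 r M Q.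
Proof. exact: sat_seq. Qed.

Lemma sat_scan_row r M : nth 0 r 1 = 1 -> nth 0 r 2 = n ->
  sat scan_row (nth 0 r 10 * 20 + 5) r M (fun r' M' => [/\ M' = M,
    frame [:: 7; 11; 14; 15; 19] r r' &
    nth 0 r' 7 = nth 0 r 7 +
      row_score (nth 0 r 12) (nth 0 M) (nth 0 r 4) (nth 0 r 10)]).
Proof.
move=> r1 r2; set a := nth 0 r 10.
pose P j r' M' := [/\ M' = M, frame [:: 7; 11; 14; 15; 19] r r' &
    nth 0 r' 7 = nth 0 r 7 + row_score (nth 0 r 12) (nth 0 M) (nth 0 r 4) j].
(* The 15 units are eight instructions and seven unfoldings of [Seq]. *)
apply: (@sat_weaken _ _ _ (a * (15 + 5) + 5) _ _ _
  (fun r' M' => [/\ nth 0 r' 1 = 1, nth 0 r' 10 = a & P a r' M'])) => //.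
  by move=> r' M' [].
apply: sat_for => //.
- move=> j r' M' u v [-> fr r7]; split => //; first by do 2 apply: frame_set => //.
  by rewrite !get_set.
- move=> j r' M' ja one jE aE [-> fr r7].
  do 7 (apply: sat_seq1; first [apply: sat_add|apply: sat_fetch|
    apply: sat_sub|apply: sat_input]; rewrite ?get_set /=).
  apply: sat_add; rewrite !get_set /=; split => //.
  split => //; first by do 8 apply: frame_set => //.
  rewrite !get_set /= r7 /row_score big_ord_recr /= addnA.
  by rewrite jE one !fr // r2.
- split => //; by rewrite /row_score big_ord0 addn0.
Qed.

Lemma sat_row_offset r M : nth 0 r 1 = 1 ->
  sat row_offset (nth 0 r 22 * 6 + 7) r M (fun r' M' => [/\ M' = M,
    frame [:: 12; 20; 21] r r' & nth 0 r' 12 = nth 0 r 22 * nth 0 r 2]).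
Proof.
move=> r1; set a := nth 0 r 22.
pose P j r' M' := [/\ M' = M, frame [:: 12; 20; 21] r r' &
    nth 0 r' 12 = j * nth 0 r 2].
apply: (@sat_weaken _ _ _ (a * (1 + 5) + 5).+2 _ _ _
  (fun r' M' => [/\ nth 0 r' 1 = 1, nth 0 r' 22 = a & P a r' M'])) => //.
- lia.
- by move=> r' M' [].
apply: sat_seq1; apply: sat_const.
apply: sat_for => //.
- move=> j r' M' u v [-> fr r12]; split => //; first by do 2 apply: frame_set => //.
  by rewrite !get_set.
- move=> j r' M' ja one jE aE [-> fr r12].
  apply: sat_add; rewrite !get_set /=; split => //.
  split => //; first by apply: frame_set.
  by rewrite !get_set /= r12 fr // mulSn addnC.
- by rewrite get_set.
- by rewrite get_set.
- split => //; first by apply: frame_set.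
  by rewrite get_set.
Qed.

Lemma sat_check_cell r M : nth 0 r 1 = 1 -> nth 0 r 2 = n -> nth 0 r 10 <= k ->
  sat check_cell (n * 6 + k * 20 + 30) r M (fun r' M' => [/\ M' = M,
    frame [:: 7; 11; 12; 13; 14; 15; 19; 20; 21; 22] r r' &
    nth 0 r' 7 = nth 0 r 7 + cell_score (nth 0 M) (nth 0 r 4) (nth 0 r 10)]).
Proof.
move=> r1 r2 ak; set a := nth 0 r 10; set s := nth 0 r 4.
pose y := nth 0 M (s + a).
apply: (@sat_weaken _ _ _ ((minn y n * 6 + 7) + (a * 20 + 5)).+1.+4.+4.+4.+2);
  [|move=> ? ? H; exact: H|].
  rewrite -/a in ak.
  have := geq_minr y n; lia.
do 7 (apply: sat_seq1; first [apply: sat_add|apply: sat_fetch|apply: sat_sub]; rewrite ?get_set /=).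
rewrite -/a -/s -/y r1 r2.
set r' := set_nth _ _ 7 (_ + _ + _).
have fr' : frame [:: 7; 13; 15; 22] r r' by do 7 (apply: frame_set => //).
have r7' : nth 0 r' 7 = nth 0 r 7 + (y - n) + (1 - y).
  by rewrite !get_set.
have r22' : nth 0 r' 22 = minn y n.
  by rewrite !get_set /=; lia.
clearbody r'; apply: sat_seq.
have := @sat_row_offset r' M; rewrite fr' // r22' => /(_ r1).
apply: sat_weaken => // r'' _ [-> fr'' r12].
have fr2 : frame [:: 7; 12; 13; 15; 20; 21; 22] r r''.
  apply: frame_trans fr'' _; first by apply/allP.
  by apply: frame_trans fr' _; first by apply/allP.
have := @sat_scan_row r'' M.
rewrite (fr2 1) // (fr2 2) // (fr2 4) // (fr2 10) // -/a -/s => /(_ r1 r2).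
apply: sat_weaken => // r3 _ [-> fr3 r7]; split => //.
  apply: frame_trans fr3 _; first by apply/allP.
  by apply: frame_trans fr2 _; first by apply/allP.
rewrite r7 fr'' // r7' r12 fr' // r2 /cell_score -/y; lia.
Qed.

Lemma sat_check_window r M : nth 0 r 1 = 1 -> nth 0 r 2 = n -> nth 0 r 3 = k ->
  sat check_window (k * (n * 6 + k * 20 + 35) + 7) r M (fun r' M' => [/\ M' = M,
    frame [:: 7; 10; 11; 12; 13; 14; 15; 18; 19; 20; 21; 22] r r' &
    nth 0 r' 7 = score (nth 0 M) (nth 0 r 4)]).
Proof.
move=> r1 r2 r3.
set W := [:: 7; 10; 11; 12; 13; 14; 15; 18; 19; 20; 21; 22].
pose P j r' M' := [/\ M' = M, frame W r r' &
    nth 0 r' 7 = \sum_(a < j) cell_score (nth 0 M) (nth 0 r 4) a].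
apply: (@sat_weaken _ _ _ (k * ((n * 6 + k * 20 + 30) + 5) + 5).+2 _ _ _
  (fun r' M' => [/\ nth 0 r' 1 = 1, nth 0 r' 3 = k & P k r' M'])) => //.
- lia.
- by move=> r' M' [].
apply: sat_seq1; apply: sat_const.
apply: sat_for => //.
- move=> j r' M' u v [-> fr r7]; split => //; first by do 2 apply: frame_set => //.
  by rewrite !get_set.
- move=> j r' M' jk one jE kE [-> fr r7].
  have := @sat_check_cell r' M one; rewrite jE (fr 2) // (fr 4) // => /(_ r2 (ltnW jk)).
  apply: sat_weaken => // r'' _ [-> fr'' r7''].
  split; rewrite ?fr'' //; split => //.
    by apply: frame_trans fr'' fr; apply/allP.
  by rewrite r7'' r7 big_ord_recr.
- by rewrite get_set.
- by rewrite get_set.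
- split => //; first by apply: frame_set.
  by rewrite get_set big_ord0.
Qed.

Definition good m s v := score (upd m s v) s = 0.

Definition check_time := k * (n * 6 + k * 20 + 35) + 7.

(** The memory may differ from [m] only at the cell under trial. A failed trial leaves registers 8
    and 9 alone, so an earlier success survives. *)
Lemma sat_try_vertex m r M : nth 0 r 1 = 1 -> nth 0 r 2 = n -> nth 0 r 3 = k ->
  nth 0 r 0 = 0 -> (forall v, upd (nth 0 M) (nth 0 r 4) v = upd m (nth 0 r 4) v) ->
  sat try_vertex (check_time + 12) r M (fun r' M' => [/\
    forall v, upd (nth 0 M') (nth 0 r 4) v = upd m (nth 0 r 4) v,
    frame [:: 6; 7; 8; 9; 10; 11; 12; 13; 14; 15; 18; 19; 20; 21; 22] r r',
    good m (nth 0 r 4) (nth 0 r 23).+1 -> good m (nth 0 r' 8) (nth 0 r' 9) &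
    good m (nth 0 r 8) (nth 0 r 9) -> good m (nth 0 r' 8) (nth 0 r' 9)]).
Proof.
move=> r1 r2 r3 r0 mE; set s := nth 0 r 4; set v := (nth 0 r 23).+1.
apply: (@sat_weaken _ _ _ ((check_time + 6).+1.+4) _ _ _); [lia|move=> ? ? H; exact: H|].
apply: sat_seq1; apply: sat_add; apply: sat_seq1; apply: sat_store.
rewrite !get_set /= r1 addn1 -/s -/v.
set r' := set_nth _ _ 6 _.
have fr' : frame [:: 6] r r' by apply: frame_set.
have r6' : nth 0 r' 6 = v by rewrite get_set.
clearbody r'; apply: sat_seq.
have := @sat_check_window r' (set_nth 0 M s v).
rewrite !fr' // => /(_ r1 r2 r3).
apply: sat_weaken => // r'' _ [-> fr'' r7].
have fr2 : frame [:: 6; 7; 10; 11; 12; 13; 14; 15; 18; 19; 20; 21; 22] r r''.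
  apply: frame_trans fr'' _; first by apply/allP.
  by apply: frame_trans fr' _; first by apply/allP.
have r6'' : nth 0 r'' 6 = v by rewrite fr''.
have M'E w : upd (nth 0 (set_nth 0 M s v)) s w = upd m s w.
  by rewrite nth_upd upd_upd mE.
have goodE : good m s v <-> nth 0 r'' 7 = 0 by rewrite r7 nth_upd mE.
apply: sat_seq1; apply: sat_sub; apply: sat_if; rewrite get_set /= (fr2 1) // r1 => r7E.
  have g : good m s v by apply/goodE; lia.
  apply: sat_seq1; apply: sat_add; apply: sat_add.
  rewrite !get_set /= r6'' (fr2 4) // (fr2 0) // r0 !addn0.
  split=> //; do 3 apply: frame_set => //.
  by apply: frame_trans fr2 _; first by apply/allP.
have ng : ~ good m s v by move/goodE; lia.
apply: (@sat_weaken _ _ _ 1); [by []|move=> ? ? H; exact: H|apply: sat_skip].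
split => //; first by apply: frame_set => //; apply: frame_trans fr2 _; first by apply/allP.
by rewrite !get_set /= !fr2.
Qed.

Lemma sat_try_position m r M : nth 0 r 1 = 1 -> nth 0 r 2 = n -> nth 0 r 3 = k ->
  nth 0 r 0 = 0 -> nth 0 M = m -> nth 0 r 5 = m (nth 0 r 4) ->
  sat try_position (n * (check_time + 17) + 12) r M (fun r' M' => [/\
    [/\ nth 0 M' = m, nth 0 r' 4 = (nth 0 r 4).+1 & nth 0 r' 5 = m (nth 0 r' 4)],
    [/\ nth 0 r' 0 = 0, nth 0 r' 1 = 1, nth 0 r' 2 = n & nth 0 r' 3 = k],
    forall v, v < n -> good m (nth 0 r 4) v.+1 -> good m (nth 0 r' 8) (nth 0 r' 9) &
    good m (nth 0 r 8) (nth 0 r 9) -> good m (nth 0 r' 8) (nth 0 r' 9)]).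
Proof.
move=> r1 r2 r3 r0 ME r5; set s := nth 0 r 4.
set W := [:: 6; 7; 8; 9; 10; 11; 12; 13; 14; 15; 17; 18; 19; 20; 21; 22; 23].
pose P j r' M' := [/\ forall v, upd (nth 0 M') s v = upd m s v,
    frame W r r',
    forall v, v < j -> good m s v.+1 -> good m (nth 0 r' 8) (nth 0 r' 9) &
    good m (nth 0 r 8) (nth 0 r 9) -> good m (nth 0 r' 8) (nth 0 r' 9)].
apply: (@sat_weaken _ _ _ ((n * ((check_time + 12) + 5) + 5) + 5).+1 _ _ _);
  [lia|move=> ? ? H; exact: H|].
apply: sat_seq.
apply: (@sat_weaken _ _ _ (n * ((check_time + 12) + 5) + 5) _ _ _
  (fun r' M' => [/\ nth 0 r' 1 = 1, nth 0 r' 2 = n & P n r' M'])) => //.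
  move=> r' M' [one two [M'E fr res res']].
  apply: sat_seq1; apply: sat_store; apply: sat_seq1; apply: sat_add; apply: sat_fetch.
  have -> : set_nth 0 M' (nth 0 r' 4) (nth 0 r' 5) = set_nth 0 M' s (m s).
    by rewrite (fr 4) // (fr 5) // r5.
  have M''E : nth 0 (set_nth 0 M' s (m s)) = m by rewrite nth_upd M'E upd_id.
  rewrite M''E !get_set /= (fr 4) // -/s one addn1.
  by split=> //; split; rewrite ?get_set //= fr.
apply: sat_for => //.
- move=> j r' M' u v [M'E fr res res']; split=> //.
  + by do 2 apply: frame_set => //.
  + by move=> w; rewrite !get_set; apply: res.
  + by rewrite !get_set.
- move=> j r' M' jn one jE two [M'E fr res res'].
  have := @sat_try_vertex m r' M' one two.
  rewrite (fr 3) // (fr 0) // (fr 4) // jE => /(_ r3 r0 M'E).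
  apply: sat_weaken => // r'' M'' [M''E fr'' g1 g2].
  split; rewrite ?fr'' //; split => //.
  + by apply: frame_trans fr'' fr; apply/allP.
  + move=> v; rewrite ltnS leq_eqVlt => /orP[/eqP -> //|vj gv].
    by apply: g2; apply: res gv.
  + by move/res'.
- by split => // v; rewrite -ME.
Qed.

Lemma sat_copy_window r M : nth 0 r 1 = 1 -> nth 0 r 3 = k -> nth 0 r 0 = 0 ->
  sat copy_window (k * 10 + 9) r M (fun r' M' =>
    (forall a, a < k -> nth 0 M' a =
       upd (nth 0 M) (nth 0 r 8) (nth 0 r 9) (nth 0 r 8 + a)) /\ nth 0 M' k = 0).
Proof.
move=> r1 r3 r0; set s := nth 0 r 8; set u := upd _ _ _.
(* Cells below j are already overwritten; the next source s + j is at least j, hence intact. *)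
pose P j r' M' := frame [:: 10; 14; 15; 18] r r' /\
  forall i, nth 0 M' i = if i < j then u (s + i) else u i.
apply: (@sat_weaken _ _ _ ((k * (5 + 5) + 5) + 1).+3 _ _ _); [lia|move=> ? ? H; exact: H|].
apply: sat_seq1; apply: sat_store; apply: sat_seq.
apply: (@sat_weaken _ _ _ (k * (5 + 5) + 5) _ _ _
  (fun r' M' => [/\ nth 0 r' 1 = 1, nth 0 r' 3 = k & P k r' M'])) => //.
  move=> r' M' [_ three [fr M'E]]; apply: sat_store.
  rewrite three (fr 0) // r0 nth_upd; split; last by rewrite /upd eqxx.
  by move=> a ak; rewrite {1}/upd ltn_eqF // M'E ak.
apply: sat_for => //.
- by move=> j r' M' v w [fr M'E]; split=> //; do 2 apply: frame_set => //.
- move=> j r' M' jk one jE three [fr M'E].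
  apply: sat_seq1; apply: sat_add; apply: sat_seq1; apply: sat_fetch; apply: sat_store.
  rewrite !get_set /= jE (fr 8) // -/s; split=> //; split=> [|i].
    by do 2 apply: frame_set => //.
  rewrite nth_upd /upd M'E ltnS; case: (ltngtP i j) => [ij|ij|->].
  + by rewrite M'E ij.
  + by rewrite M'E ltnNge (ltnW ij).
  + by rewrite ltnNge leq_addl.
- by split=> // i; rewrite nth_upd.
Qed.

Lemma sat_extract_clique r M : nth 0 x 0 = n -> nth 0 x 1 = k ->
  sat extract_clique
    (index 0 M * (n * (check_time + 17) + 13) + k * 10 + 27) r M
    (fun r' M' => forall s v, s < index 0 M -> v < n -> good (nth 0 M) s v.+1 ->
       exists s' v', [/\ good (nth 0 M) s' v',
         forall a, a < k -> nth 0 M' a = upd (nth 0 M) s' v' (s' + a) &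
         nth 0 M' k = 0]).
Proof.
move=> x0 x1; set L := index 0 M; set m := nth 0 M.
apply: (@sat_weaken _ _ _ ((L * (n * (check_time + 17) + 12).+1 + 1) +
  (k * 10 + 9)).+1.+4.+4.+4.+4 _ _ _);
  [lia|move=> ? ? H; exact: H|].
do 8 (apply: sat_seq1;
  first [apply: sat_const|apply: sat_input|apply: sat_fetch]; rewrite ?get_set /=).
rewrite x0 x1 -/m.
set r' := set_nth _ _ 5 _.
have [r0' r1' r2' r3'] : [/\ nth 0 r' 0 = 0, nth 0 r' 1 = 1, nth 0 r' 2 = n & nth 0 r' 3 = k].
  by rewrite /r' !get_set.
have [r4' r5'] : nth 0 r' 4 = 0 /\ nth 0 r' 5 = m 0 by rewrite /r' !get_set.
clearbody r'; apply: sat_seq.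
pose I j r M' := [/\ [/\ j <= L, nth 0 M' = m, nth 0 r 4 = L - j & nth 0 r 5 = m (L - j)],
  [/\ nth 0 r 0 = 0, nth 0 r 1 = 1, nth 0 r 2 = n & nth 0 r 3 = k] &
  forall s v, s < L - j -> v < n -> good m s v.+1 -> good m (nth 0 r 8) (nth 0 r 9)].
(* If no cell is zero, L is the size of the memory and the default 0 is read there, so the main loop
   still stops at L. *)
have mL : m L = 0.
  have [in0|] := boolP (0 \in M); first exact: nth_index.
  by rewrite -index_mem -leqNgt => le; apply: nth_default.
have m_neq0 i : i < L -> m i <> 0 by move=> iL; apply/eqP; have /= -> := before_find 0 iL.
apply: (@sat_weaken _ _ _ (L * (n * (check_time + 17) + 12).+1 + 1) _ _ _ (I 0)) => //.
  move=> r2 M2 [[_ ME _ _] [e0 e1 e2 e3] found].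
  have := sat_copy_window M2 e1 e3 e0; apply: sat_weaken => // r3 M3 [copy last].
  move=> s v sL vn gsv; exists (nth 0 r2 8), (nth 0 r2 9); split=> //.
    by apply: found gsv; rewrite ?subn0.
  by move=> a ak; rewrite copy // ME.
apply: (@sat_while _ _ _ _ _ L _ _ I).
- move=> j r2 M2 [[jL ME r4 r5] [e0 e1 e2 e3] found]; split.
    by rewrite r5; apply: m_neq0; lia.
  have r54 : nth 0 r2 5 = m (nth 0 r2 4) by rewrite r4.
  have := sat_try_position e1 e2 e3 e0 ME r54; apply: sat_weaken => //.
  move=> r3 M3 [[ME3 r34 r35] env g1 g2]; have Lj : (L - j.+1).+1 = L - j by lia.
  split=> //; first by split; rewrite ?(ltnW jL) // ?r35 r34 r4 Lj.
  move=> s v; rewrite -Lj ltnS leq_eqVlt => /orP[/eqP sE|sL] vn gsv.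
    by apply: (g1 v) => //; rewrite r4 -sE.
  by apply: g2; apply: (found s v).
- by move=> r2 M2 [[_ _ _ ->] _ _]; rewrite subn0.
- by split=> //; rewrite ?subnn.
Qed.

End WindowSearch.

(** * Adjacency matrix entries and correctness of the search *)

Lemma nth_allpairs (S T U : Type) (s0 : S) (t0 : T) (u0 : U) (f : S -> T -> U)
    (s : seq S) (t : seq T) a b : a < size s -> b < size t ->
  nth u0 [seq f i j | i <- s, j <- t] (a * size t + b) = f (nth s0 s a) (nth t0 t b).
Proof.
elim: s a => // i s IH [|a] /= als blt; rewrite nth_cat size_map.
  by rewrite add0n blt (nth_map t0).
have -> : a.+1 * size t + b < size t = false by apply/negbTE; rewrite -leqNgt mulSn; lia.
by have -> : a.+1 * size t + b - size t = a * size t + b; [rewrite mulSn; lia | apply: IH].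
Qed.

Lemma nth_encode n k (E : {set {set 'I_n}}) (i j : 'I_n) :
  nth 0 (encode k E) (i * n + j).+2 = ([set i; j] \in E).
Proof.
rewrite /encode /=.
have := @nth_allpairs _ _ _ i j 0 (fun i j => nat_of_bool ([set i; j] \in E))
  (enum 'I_n) (enum 'I_n) i j.
by rewrite !size_enum_ord !nth_ord_enum; apply.
Qed.

(** The numbers of the vertices form a duplicate-free list contained in w and of the same length, so
    w is a permutation of it. *)
Lemma card_vertices n (w : seq nat) : #|vertices_of n w| = size w ->
  uniq w /\ all (fun y => 0 < y <= n) w.
Proof.
move=> cw; pose t := [seq (val v).+1 | v <- enum (vertices_of n w)].
have ut : uniq t by rewrite map_inj_uniq ?enum_uniq // => i j [] /val_inj.
have sub : {subset t <= w}.
  by move=> y /mapP[v]; rewrite mem_enum inE => vw ->.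
have st : size w <= size t by rewrite size_map -cardE cw.
have [_ tw] := uniq_min_size ut sub st.
split; first exact: leq_size_uniq ut sub st.
by apply/allP => y; rewrite -tw => /mapP[v _ ->] /=; rewrite ltn_ord.
Qed.

Lemma card_vertices_uniq n (w : seq nat) : uniq w ->
  all (fun y => 0 < y <= n) w -> #|vertices_of n w| = size w.
Proof.
move=> uw /allP rw; rewrite cardE -(size_map (fun v : 'I_n => (val v).+1)).
apply: perm_size; apply: uniq_perm => //.
  by rewrite map_inj_uniq ?enum_uniq // => i j [] /val_inj.
move=> y; apply/mapP/idP => [[v]|yw]; first by rewrite mem_enum inE => vw ->.
have /andP[y0 yn] := rw y yw; have yn' : y.-1 < n by rewrite prednK.
by exists (Ordinal yn'); rewrite /= ?mem_enum ?inE /= prednK.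
Qed.

Section Correctness.
Variables (n k : nat) (E : {set {set 'I_n}}).
Hypothesis E_pairs : E \subset pairs n.
Local Notation x := (encode k E).

(** Score 0 also forces distinct vertices: a repetition would need a loop, and [E] contains only
    two-element sets. *)
Lemma good_window m s v : good x n k m s v <->
  clique_found k E [seq upd m s v (s + a) | a <- iota 0 k].
Proof.
set u := upd m s v; set w := [seq _ | a <- _].
have sw : size w = k by rewrite size_map size_iota.
have nthw a : a < k -> nth 0 w a = u (s + a).
  by move=> ak; rewrite (nth_map 0) ?size_iota // nth_iota.
have adjE a b : 0 < u (s + a) <= n -> 0 < u (s + b) <= n ->
    exists i j : 'I_n, [/\ u (s + a) = i.+1, u (s + b) = j.+1 &
      nth 0 x (minn (u (s + a)) n * n + u (s + b) + 1 - n) = ([set i; j] \in E)].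
  move=> /andP[a0 an] /andP[b0 bn].
  have ia : (u (s + a)).-1 < n by rewrite prednK.
  have jb : (u (s + b)).-1 < n by rewrite prednK.
  exists (Ordinal ia), (Ordinal jb); rewrite /= !prednK //; split=> //.
  rewrite -(nth_encode k); congr (nth 0 _ _).
  rewrite (minn_idPl an) /=; move: a0 b0 {an bn ia jb}.
  by case: (u (s + a)) => // p; case: (u (s + b)) => // q _ _ /=; rewrite mulSn; lia.
rewrite /good /score; split.
  move=> /eqP; rewrite sum_nat_eq0 => /forallP sc.
  have cell a : a < k -> 0 < u (s + a) <= n /\ row_score x n (minn (u (s + a)) n * n) u s a = 0.
    move=> ak; have /= := sc (Ordinal ak); rewrite /cell_score -/u !addn_eq0.
    by rewrite !subn_eq0 => /andP[/andP[-> ->] /eqP].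
  have adj a b : b < a -> a < k ->
      exists i j : 'I_n, [/\ u (s + a) = i.+1, u (s + b) = j.+1 & [set i; j] \in E].
    move=> ba ak; have [ra /eqP] := cell a ak; have [rb _] := cell b (ltn_trans ba ak).
    rewrite /row_score sum_nat_eq0 => /forallP /(_ (Ordinal ba)) /=.
    have [i [j [-> -> ->]]] := adjE a b ra rb.
    by case: (boolP ([set i; j] \in E)) => // ijE _; exists i, j.
  have neq a b : b < a -> a < k -> u (s + a) != u (s + b).
    move=> ba ak; have [i [j [-> -> ijE]]] := adj a b ba ak.
    have /(subsetP E_pairs) := ijE; rewrite inE cards2; case: (i =P j) => // ij _.
    by apply/eqP => -[] /val_inj /ij.
  have uw : uniq w.
    apply/(uniqP 0) => a b; rewrite !inE sw => ak bk; rewrite !nthw //.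
    case: (ltngtP a b) => // ab /eqP; last by rewrite (negbTE (neq _ _ ab ak)).
    by rewrite eq_sym (negbTE (neq _ _ ab bk)).
  have rw : all (fun y => 0 < y <= n) w.
    apply/(all_nthP 0) => a; rewrite sw => ak; rewrite nthw //.
    by case: (cell a ak).
  apply/andP; split; last by rewrite card_vertices_uniq // sw.
  apply/forallP => i; apply/implyP; rewrite inE => /(nthP 0)[a]; rewrite sw => ak.
  rewrite nthw // => ui; apply/forallP => j; apply/implyP; rewrite inE.
  move=> /(nthP 0)[b]; rewrite sw => bk; rewrite nthw // => uj; apply/implyP => ij.
  case: (ltngtP a b) => ab; last first.
  - by case/eqP: ij; apply/val_inj; move: ui uj; rewrite ab => -> [].
  - have [i' [j' []]] := adj a b ab ak; rewrite ui uj => -[] /val_inj <- [] /val_inj <-.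
    by [].
  - have [i' [j' []]] := adj b a ab bk; rewrite ui uj => -[] /val_inj <- [] /val_inj <-.
    by rewrite setUC.
move=> /andP[cl /eqP cw].
have [uw rw] : uniq w /\ all (fun y => 0 < y <= n) w.
  by apply: card_vertices; rewrite cw sw.
have range a : a < k -> 0 < u (s + a) <= n.
  by move=> ak; have := all_nthP 0 rw a; rewrite sw nthw //; apply.
apply/eqP; rewrite sum_nat_eq0; apply/forallP => -[a ak] /=.
rewrite /cell_score -/u !addn_eq0 !subn_eq0; have /andP[-> ->] /= := range a ak.
rewrite sum_nat_eq0; apply/forallP => -[b ba] /=.
have bk := ltn_trans ba ak.
have [i [j [ui uj ->]]] := adjE a b (range a ak) (range b bk).
suff -> : [set i; j] \in E by [].
move: cl => /forallP /(_ i); rewrite inE => /implyP.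
have -> : i.+1 \in w by rewrite -ui -nthw // mem_nth ?sw.
move=> /(_ isT) /forallP /(_ j); rewrite inE => /implyP.
have -> : j.+1 \in w by rewrite -uj -nthw // mem_nth ?sw.
move=> /(_ isT) /implyP; apply; apply/eqP => ij.
have /eqP : nth 0 w a = nth 0 w b by rewrite !nthw // ui uj ij.
by rewrite nth_uniq ?sw // => /eqP ab; rewrite ab ltnn in ba.
Qed.

(** The first k cells are nonzero, so the output stops exactly at the zero in cell k. *)
Lemma output_prefix M f : (forall a, a < k -> nth 0 M a = f a /\ f a != 0) ->
  nth 0 M k = 0 -> take (index 0 M) M = [seq f a | a <- iota 0 k].
Proof.
move=> Mf Mk.
have kM : k <= size M.
  rewrite leqNgt; apply/negP => lt; have [] := Mf _ lt.
  by rewrite nth_default // => <-.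
have ik : index 0 M = k.
  apply/eqP; rewrite eqn_leq; apply/andP; split; rewrite leqNgt; apply/negP => lt.
    by have := before_find 0 lt; rewrite Mk.
  have [e /negP] := Mf _ lt; apply; rewrite -e nth_index //.
  by rewrite -index_mem (leq_trans lt).
rewrite ik; apply: (@eq_from_nth _ 0); first by rewrite size_takel // size_map size_iota.
move=> a; rewrite size_takel // => ak.
by rewrite nth_take // (nth_map 0) ?size_iota // nth_iota //; have [] := Mf a ak.
Qed.

(* Cell [s] is that of the coefficient, for which the program substitutes the
  extending vertex; [s] need not be a multiple of [k]. *)
Definition extendable_block : pred (seq nat) := fun w =>
  `[< exists s v, [/\ 0 < k, s + k <= size w, v < n &
        clique_found k E (v.+1 :: take k.-1 (drop s.+1 w))] >].

Definition extract_time (L : nat) :=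
  L * (n * (check_time n k + 17) + 13) + k * 10 + 27.

Lemma index_live M : index 0 M <= live M.
Proof. by elim: M => //= a M IH; case: eqP => _ //=; rewrite add1n ltnS. Qed.

(** Writing v+1 in cell s turns an extendable block into a good window. The search may end on
    another good window, but every good window is a clique. *)
Lemma extract_clique_spec (R : realType) (T : nat) :
  output_spec R x T (extract_time T) extract_clique extendable_block (clique_found k E).
Proof.
move=> r M liveM.
have [t [r' [M' [tT run found]]]] := @sat_extract_clique R x n k r M erefl erefl.
exists t, r', M'; split=> [|psi|].
- apply: leq_trans tT _; rewrite /extract_time !leq_add2r leq_mul2r.
  by rewrite (leq_trans (index_live M)) ?orbT.
- exact: run.
move=> /asboolP[s [v [k0 sk vn cl]]].
have sL : s + k <= index 0 M.
  by move: sk; rewrite size_take; case: ltnP => // le sk; apply: leq_trans sk _.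
have gsv : good x n k (nth 0 M) s v.+1.
  apply/good_window; move: cl; congr (clique_found _ _ _).
  case: k k0 sk sL => // k' _ sk sL /=; rewrite addn0 {1}/upd eqxx; congr cons.
  apply: (@eq_from_nth _ 0).
    by rewrite size_takel ?size_drop ?size_map ?size_iota //; lia.
  move=> a; rewrite size_takel ?size_drop; last by lia.
  move=> ak; rewrite nth_take // nth_drop (nth_map 0) ?size_iota // nth_iota //.
  rewrite nth_take; last by lia.
  by rewrite /upd addnA addn1 gtn_eqF //; lia.
have sM : s < index 0 M by lia.
have [s' [v' [gsv' M'E M'k]]] := found s v sM vn gsv.
have /good_window cl' := gsv'.
rewrite (@output_prefix M' (fun a => upd (nth 0 M) s' v' (s' + a))) // => a ak.
split; first exact: M'E.
move: cl' => /andP[_ /eqP cw].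
set w := [seq _ | a <- _] in cw.
have [|_ /allP rw] := @card_vertices n w; first by rewrite cw size_map size_iota.
have /rw/andP[] : upd (nth 0 M) s' v' (s' + a) \in w; last by rewrite lt0n.
by apply/mapP; exists a; rewrite ?mem_iota.
Qed.

End Correctness.

(** * Polynomial running time of the combined program *)

Definition search_exponent d := 200 * d.+1.

Lemma extract_time_bound d n k : k <= n ->
  time_bound d n + extract_time n k (time_bound d n) < time_bound (search_exponent d) n.
Proof.
move=> kn; rewrite /time_bound /extract_time /check_time /search_exponent.
(* For n at most 1 powers of n do not grow, and the additive part 200(d+1) of [time_bound] has to
   dominate. *)
have [n1|n2] := leqP n 1.
  have nd1 e : n ^ e <= 1 by case: n n1 {kn} => [|[|]] // _; rewrite ?exp1n //;
    case: e => // e; rewrite exp0n.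
  have := nd1 d; nia.
set T := n ^ d + d.
(* This uses d < n^d for n at least 2. *)
have Tle : T <= n ^ (2 * d).
  rewrite mul2n -addnn expnD /T; have := ltn_expl d n2; nia.
have pow e f : e <= f -> n ^ e <= n ^ f by rewrite leq_exp2l.
have two e : 2 ^ e <= n ^ e by case: e => // e; rewrite leq_exp2r.
(* The cubic is at most 128 n^3, and 128 = 2^7 is at most n^7. *)
have chk : n * (k * (n * 6 + k * 20 + 35) + 7 + 17) + 13 <= n ^ 10.
  have := two 7; rewrite (_ : n ^ 10 = n ^ 7 * (n * n * n)); last first.
    by rewrite (expnD n 7 3); congr (_ * _); rewrite !expnS expn0 muln1 mulnA.
  rewrite (_ : 2 ^ 7 = 128) // => n7.
  have h1 : k * (n * 6 + k * 20 + 35) <= n * (n * 26 + 35) by apply: leq_mul => //; lia.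
  apply: (@leq_trans (128 * (n * n * n))); last by rewrite leq_mul2r n7 orbT.
  apply: (@leq_trans (n * (n * (n * 26 + 35) + 24) + 13)).
    by rewrite leq_add2r leq_mul2l; apply/orP; right; lia.
  have h2 : 2 * (n * n) <= n * n * n by rewrite [leqLHS]mulnC leq_mul2l n2 orbT.
  have h3 : 2 * n <= n * n by rewrite leq_mul2r n2 orbT.
  rewrite !mulnDr !mulnA; lia.
(* The factors n^(2d) and n^10 bound [T] and the cost per position; a second n^10 absorbs the
   remaining terms. *)
apply: (@leq_trans (n ^ (2 * d) * n ^ 20)); last first.
  by rewrite -expnD; apply: leq_trans (pow _ _ _) (leq_addr _ _); lia.
have nd0 : 0 < n ^ (2 * d) by rewrite expn_gt0; lia.
have -> : n ^ 20 = n ^ 10 * n ^ 10 by rewrite -expnD.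
have n10 : 1024 * n <= 2 * n ^ 10.
  by have := two 9; rewrite (_ : 2 ^ 9 = 512) // (expnS n 9); nia.
set A := n ^ 10 in chk n10 *; set N := n ^ (2 * d) in Tle nd0 *.
set B := n * _ + 13 in chk *.
have : T * B <= N * A by apply: leq_mul.
have A1024 : 1024 <= A by lia.
have : N * A * 1024 <= N * (A * A) by rewrite -mulnA !leq_mul2l A1024 !orbT.
have : 1 * A <= N * A by rewrite leq_mul2r nd0 orbT.
have : N * 1 <= N * A by rewrite leq_mul2l; lia.
rewrite muln1 mul1n; move: (N * A) (N * (A * A)) (T * B) => a b c; lia.
Qed.

Lemma output_specW (R : realType) x B Q Q' q ev ev' : Q <= Q' ->
  output_spec R x B Q q ev ev' -> output_spec R x B Q' q ev ev'.
Proof.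
move=> QQ spec r M liveM; have [t [r' [M' [tQ ? ?]]]] := spec r M liveM.
by exists t, r', M'; split=> //; apply: leq_trans QQ.
Qed.

Lemma efficient_search (R : realType) m p d : efficient R m p d ->
  efficient R m (Seq p extract_clique) (search_exponent d).
Proof.
move=> [cl hp]; split; first by case: cl => [->|clp]; [left | right; rewrite /= clp].
move=> n k E kn Ep; have := extract_time_bound d kn.
set T := time_bound d n => lt.
(* All time beyond T goes to the search, less the unit that unfolds [Seq]. *)
have -> : time_bound (search_exponent d) n =
    (T + (time_bound (search_exponent d) n - T).-1).+1 by lia.
apply: halts_within_seq; last exact: hp.
by apply: output_specW (@extract_clique_spec _ _ _ Ep R T); rewrite -/T; lia.
Qed.

Lemma prob_search (R : realType) p d n k (E : {set {set 'I_n}}) :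
  k <= n -> E \subset pairs n ->
  (prob R (encode k E) (time_bound d n) p (extendable_block k E) <=
   prob R (encode k E) (time_bound (search_exponent d) n)
     (Seq p extract_clique) (clique_found k E))%R.
Proof.
move=> kn Ep; have := extract_time_bound d kn.
set T := time_bound d n => lt.
have -> : time_bound (search_exponent d) n =
    (T + (time_bound (search_exponent d) n - T).-1).+1 by lia.
apply: prob_seq.
by apply: output_specW (@extract_clique_spec _ _ _ Ep R T); rewrite -/T; lia.
Qed.

Lemma nth_reshape_nseq (T : Type) (w : seq T) a k i : i < a ->
  nth [::] (reshape (nseq a k) w) i = take k (drop (i * k) w).
Proof.
elim: a i w => // a IH [|i] w /=; first by rewrite mul0n drop0.
by rewrite ltnS => /IH ->; rewrite drop_drop mulSn addnC.
Qed.

(** A nonzero coefficient at s forces some block to list s. Its first cell, which encodes the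
    coefficient, is where the extending vertex can be put. *)
Lemma support_block (R : realType) (coef : nat -> R) n k (G : {set {set 'I_n}}) w
    (s : {set 'I_n}) (v : 'I_n) :
  0 < k -> #|s| = k.-1 -> v \notin s -> clique G (v |: s) ->
  chain_of_output n coef k w s != 0%R -> extendable_block k G w.
Proof.
move=> k0 cs vs cl; rewrite ffunE => sum0.
have [b bw bs] : exists2 b, b \in reshape (nseq (size w %/ k) k) w &
    vertices_of n (behead b) = s.
  apply/exists2P; apply: contrapT => no; case/eqP: sum0.
  rewrite big_seq big1 // => b bw; case: eqP => // bs.
  by case: no; exists b.
have [i ia bE] := nthP [::] bw; move: ia bE; rewrite size_reshape size_nseq => ia.
rewrite nth_reshape_nseq // => bE.
apply/asboolP; exists (i * k), v; split=> //.
  by rewrite addnC -mulSn (leq_trans (leq_mul ia (leqnn k))) // leq_divM.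
have tailE : behead b = take k.-1 (drop (i * k).+1 w).
  rewrite -bE -addn1 addnC -drop_drop drop1.
  by case: (drop (i * k) w) => [|? ?]; case: (k) k0 => //.
rewrite -tailE /clique_found.
have -> : vertices_of n (v.+1 :: behead b) = v |: s.
  by apply/setP => u; rewrite -bs !inE eqSS.
by rewrite cl cardsU1 vs cs add1n prednK // eqxx.
Qed.

(** * Rarity of obstructions *)

Lemma cliqueP n (E : {set {set 'I_n}}) (s : {set 'I_n}) :
  reflect {in s &, forall u v, u != v -> [set u; v] \in E} (clique E s).
Proof.
apply: (iffP forallP) => [cl u v us vs uv|cl u].
  have /implyP/(_ us)/forallP/(_ v) := cl u.
  by move=> /implyP/(_ vs)/implyP/(_ uv).
apply/implyP => us; apply/forallP => v; apply/implyP => vs; apply/implyP.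
exact: cl.
Qed.

Lemma clique_setU1 n (E : {set {set 'I_n}}) (s : {set 'I_n}) v :
  clique E s -> (forall u, u \in s -> u != v -> [set u; v] \in E) -> clique E (v |: s).
Proof.
move=> /cliqueP cl adj; apply/cliqueP => a b.
move=> /setU1P[->|sa] /setU1P[->|sb] ab.
- by rewrite eqxx in ab.
- by rewrite setUC adj // eq_sym.
- exact: adj.
- exact: cl.
Qed.

(** The combinatorial trace of a non-extending simplex in the support of a cycle: a maximal clique
    of size k-1, each facet of which completes to another clique of that size. *)
Definition obstruction n k (G : {set {set 'I_n}}) : bool :=
  [exists s : {set 'I_n}, [&& #|s| == k.-1, clique G s,
    [forall v, (v \notin s) ==> ~~ clique G (v |: s)] &
    [forall u in s, [exists v, (v \notin s) && clique G (v |: (s :\ u))]]]].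

Section Pattern.
Variables (n r : nat).
Implicit Types (f : {ffun 'I_r -> 'I_n * 'I_n}) (S : {set 'I_n}).

(* [(f i).2] enumerates the vertices of the simplex and [(f i).1] is a vertex
  outside S: the same vertex, or its substitute in a neighbouring simplex. *)
Definition pattern S f : bool :=
  [&& injectiveb (fun i => (f i).1), injectiveb (fun i => (f i).2) &
    [forall i, ((f i).1 \notin S) && (((f i).2 == (f i).1) || ((f i).2 \in S))]].

Definition pattern_edges f : {set {set 'I_n}} :=
  [set [set (f ij.1).1; (f ij.2).2] | ij in [set ij : 'I_r * 'I_r | ij.1 < ij.2]].

Lemma obstruction_pattern k (E : {set {set 'I_n}}) S : r = k.-1 ->
  E \subset pairs n -> obstruction k (plant E S) ->
  exists2 f, pattern S f & pattern_edges f \subset E.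
Proof.
move=> rk Ep /existsP[s /and4P[/eqP cs /cliqueP cl /forallP noext /forallP cof]].
have cs' : r = #|s| by rewrite cs.
(* Planting adds only edges with both ends in S. *)
have inG u v : u \notin S -> [set u; v] \in plant E S -> [set u; v] \in E.
  move=> uS; rewrite !inE => /orP[//|/andP[_ /subsetP sub]].
  by have := sub u; rewrite !inE eqxx (negbTE uS) => /(_ isT).
pose sg (i : 'I_r) : 'I_n := enum_val (cast_ord cs' i).
have sg_s i : sg i \in s by apply: enum_valP.
have sg_inj : injective sg by move=> i j /enum_val_inj /cast_ord_inj.
have vex u : u \in s -> exists v, [/\ v \notin s, [set u; v] \notin plant E S &
    forall u', u' \in s -> u' != u -> [set v; u'] \in plant E S].
  move=> us; have /implyP/(_ us)/existsP[v /andP[vs /cliqueP clv]] := cof u.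
  have adj u' : u' \in s -> u' != u -> [set v; u'] \in plant E S.
    move=> u's u'u; apply: clv; rewrite ?inE ?eqxx ?u'u ?u's ?orbT //.
    by apply: contraNneq vs => ->.
  exists v; split=> //; apply/negP => uv; have /implyP/(_ vs)/negP := noext v; apply.
  apply: clique_setU1; first exact/cliqueP.
  by move=> w ws wv; have [->//|wu] := eqVneq w u; rewrite setUC adj.
(* This fixes one substitute v_u; for u in s the default is never reached. *)
pose alt u := odflt u [pick v | [&& v \notin s, [set u; v] \notin plant E S &
    [forall u' in s, (u' != u) ==> ([set v; u'] \in plant E S)]]].
have altP u : u \in s -> [/\ alt u \notin s, [set u; alt u] \notin plant E S &
    forall u', u' \in s -> u' != u -> [set alt u; u'] \in plant E S].
  rewrite /alt; case: pickP => /= [v /and3P[vs uv /forallP adj] us|no us].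
    by split=> // u' u's u'u; have /implyP/(_ u's)/implyP/(_ u'u) := adj u'.
  have [v [vs uv adj]] := vex u us; have /and3P := no v; case; split=> //.
  by apply/forallP => u'; apply/implyP => u's; apply/implyP => u'u; apply: adj.
pose w i := if sg i \in S then alt (sg i) else sg i.
(* If u and v_u were both in S, planting would join them. *)
have wS i : w i \notin S.
  rewrite /w; case: ifP => [iS|->//]; have [as_ na _] := altP _ (sg_s i).
  apply: contra na => aS; rewrite !inE; apply/orP; right; apply/andP; split.
    by rewrite cards2; case: (sg i =P alt _) => // e; rewrite -e sg_s in as_.
  by apply/subsetP => u; rewrite !inE => /orP[] /eqP ->.
have w_adj i j : i != j -> [set w i; sg j] \in plant E S.
  move=> ij; have nij : sg j != sg i by rewrite (inj_eq sg_inj) eq_sym.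
  rewrite /w; case: ifP => _; last by apply: cl; rewrite // eq_sym.
  by have [_ _] := altP _ (sg_s i); apply.
have w_inj : injective w.
  move=> i j wij; apply/eqP; apply: contraT => ij.
  have nij : sg i != sg j by rewrite (inj_eq sg_inj).
  move: wij; rewrite /w; case: ifP => iS; case: ifP => jS e.
  - have [_ /negP no _] := altP _ (sg_s i); case: no.
    by rewrite e setUC; have [_ _] := altP _ (sg_s j); apply.
  - by have [] := altP _ (sg_s i); rewrite e sg_s.
  - by have [] := altP _ (sg_s j); rewrite -e sg_s.
  - by rewrite e eqxx in nij.
exists [ffun i => (w i, sg i)].
  apply/and3P; split.
  - by apply/injectiveP => i j; rewrite !ffunE => /w_inj.
  - by apply/injectiveP => i j; rewrite !ffunE => /sg_inj.
  apply/forallP => i; rewrite ffunE /= wS /= /w; case: ifP => _; rewrite ?eqxx ?orbT //.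
apply/subsetP => e /imsetP[[i j]]; rewrite inE /= => ij ->; rewrite !ffunE /=.
by apply: inG => //; apply: w_adj; rewrite -val_eqE /= ltn_eqF.
Qed.

(** [(f j).2] is [(f j).1] or lies in S, while [(f i).1] avoids S; so the two ends of an edge can
    coincide only for i = j. *)
Lemma pattern_edges_pairs S f : pattern S f -> pattern_edges f \subset pairs n.
Proof.
move=> /and3P[/injectiveP inj1 /injectiveP inj2 /forallP pat].
apply/subsetP => e /imsetP[[i j]]; rewrite inE /= => ij ->; rewrite inE cards2.
case: ((f i).1 =P (f j).2) => //= e1; have /andP[iS /orP[/eqP e2|jS]] := pat j.
  have /inj1 ijE : (f i).1 = (f j).1 by rewrite e1.
  by rewrite ijE ltnn in ij.
by have /andP[] := pat i; rewrite e1 jS.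
Qed.

(** Two equal edges with swapped ends would give i = j' and j = i', against i < j and i' < j'. *)
Lemma card_pattern_edges S f : pattern S f -> #|pattern_edges f| = 'C(r, 2).
Proof.
move=> /and3P[/injectiveP inj1 /injectiveP inj2 /forallP pat].
have second i j : (f i).1 = (f j).2 -> i = j.
  move=> e; have /andP[_ /orP[/eqP e2|jS]] := pat j; first by apply: inj1; rewrite e.
  by have /andP[] := pat i; rewrite e jS.
rewrite card_in_imset => [|[i j] [i' j']].
  rewrite -sum1_card (eq_bigl (fun ij : 'I_r * 'I_r => true && (ij.1 < ij.2))); last first.
    by move=> ij; rewrite inE.
  rewrite -(pair_big_dep xpredT (fun i j : 'I_r => i < j) (fun _ _ => 1)) /=.
  rewrite (exchange_big_dep xpredT) //= -bin2_sum big_mkord; apply: eq_bigr => j _.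
  by rewrite -(big_ord_widen r (fun=> 1) (ltnW (ltn_ord j))) sum1_card card_ord.
rewrite !inE /= => ij ij' e.
have : (f i).1 \in [set (f i').1; (f j').2] by rewrite -e !inE eqxx.
have : (f j).2 \in [set (f i').1; (f j').2] by rewrite -e !inE eqxx orbT.
rewrite !inE => /orP[/eqP e2|/eqP /inj2 ej] /orP[/eqP /inj1 ei|/eqP e1].
- by rewrite ei (second _ _ (esym e2)) ltnn in ij.
- by move: ij ij'; rewrite (second _ _ (esym e2)) (second _ _ e1) ltnNge => /negP h /ltnW.
- by rewrite ei ej.
- by rewrite (second _ _ e1) ej ltnn in ij.
Qed.

(** For each i there are n choices of [(f i).1], and [(f i).2] is the same vertex or one of S. *)
Lemma card_pattern S : #|[set f | pattern S f]| <= (n * #|S|.+1) ^ r.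
Proof.
pose A := [set p : 'I_n * 'I_n | (p.2 == p.1) || (p.2 \in S)].
have cA : #|A| <= n * #|S|.+1.
  pose B (a : 'I_n) := a |: S.
  rewrite -sum1_card (eq_bigl (fun p => true && (p.2 \in B p.1))); last first.
    by move=> p; rewrite !inE.
  rewrite -(pair_big_dep xpredT (fun a b => b \in B a) (fun _ _ => 1)) /=.
  rewrite -[X in X * _]card_ord -sum_nat_const; apply: leq_sum => a _.
  by rewrite sum1_card cardsU1; case: (a \notin S); rewrite ?add1n ?add0n.
apply: (@leq_trans (#|A| ^ r)); last by case: (r) => // r'; rewrite leq_exp2r.
rewrite -[X in _ ^ X]card_ord -card_ffun_on; apply: subset_leq_card.
apply/subsetP => f; rewrite inE => /and3P[_ _ /forallP pat].
by apply/ffun_onP => i; rewrite inE; case/andP: (pat i).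
Qed.

End Pattern.

Lemma card_supersets (T : finType) (F P : {set T}) : F \subset P ->
  #|[set E in powerset P | F \subset E]| = 2 ^ (#|P| - #|F|).
Proof.
move=> FP; rewrite -cardsDS // -card_powerset.
rewrite -(@card_in_imset _ _ (fun E : {set T} => E :|: F) (powerset (P :\: F))).
  congr #|pred_of_set _|; apply/setP => E; rewrite !inE; apply/andP/imsetP.
    move=> [EP FE]; exists (E :\: F); first by rewrite inE setSD.
    by rewrite -{1}(setID E F) (setIidPr FE) setUC.
  move=> [D]; rewrite inE subsetD => /andP[DP _] ->.
  by rewrite subUset DP FP subsetUr.
move=> D D'; rewrite !inE !subsetD => /andP[_ dD] /andP[_ dD'] e.
have : (D :|: F) :\: F = (D' :|: F) :\: F by rewrite e.
by rewrite !setDUl !setDv !setU0 (setDidPl dD) (setDidPl dD').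
Qed.

(** * Union bound over patterns *)

Section ObstructionProbability.
Variable R : realType.
Local Open Scope ring_scope.

Lemma er_pmf_half n (E : {set {set 'I_n}}) :
  er_pmf (2%:R^-1) E = 2%:R^-1 ^+ #|pairs n| :> R.
Proof.
rewrite /er_pmf (eq_bigr (fun=> 2%:R^-1)); first by rewrite prodr_const.
by move=> e _; case: ifP => // _; field.
Qed.

Lemma er_half_supersets n (F : {set {set 'I_n}}) : F \subset pairs n ->
  \sum_(E in powerset (pairs n) | F \subset E) er_pmf (2%:R^-1) E =
  2%:R^-1 ^+ #|F| :> R.
Proof.
move=> FP; under eq_bigr do rewrite er_pmf_half.
rewrite (eq_bigl (mem [set E in powerset (pairs n) | F \subset E])) => [|E].
  rewrite sumr_const card_supersets //.
  rewrite -[LHS]mulr_natl natrX -{2}(subnK (subset_leq_card FP)) exprD mulrA -exprMn.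
  by rewrite mulfV ?pnatr_eq0 // expr1n mul1r.
by rewrite [RHS]inE.
Qed.

(** A pattern prescribes ['C(r, 2)] distinct edges, each present with probability 1/2. *)
Lemma obstruction_prob n k (S : {set 'I_n}) : #|S| = k ->
  \sum_(E in powerset (pairs n)) er_pmf (2%:R^-1) E * (obstruction k (plant E S))%:R
  <= (n * k.+1)%:R ^+ k.-1 * 2%:R^-1 ^+ 'C(k.-1, 2) :> R.
Proof.
move=> cS; set r := k.-1.
apply: (@le_trans _ _ (\sum_(f | pattern (r := r) S f)
    \sum_(E in powerset (pairs n) | pattern_edges f \subset E) er_pmf (2%:R^-1) E)).
  rewrite (exchange_big_dep (mem (powerset (pairs n)))) /=; last by move=> ? ? _ /andP[].
  apply: ler_sum => E; rewrite inE => EP; rewrite sumr_const er_pmf_half.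
  case: (boolP (obstruction _ _)) => [|_]; last by rewrite mulr0 mulrn_wge0 ?exprn_ge0 ?invr_ge0.
  rewrite mulr1 => /(obstruction_pattern (erefl r) EP)[f pf fE].
  rewrite -[leLHS]mulr1n ler_wpMn2l ?exprn_ge0 ?invr_ge0 //.
  apply/card_gt0P; exists f; by rewrite unfold_in /= pf fE EP.
rewrite (eq_bigr (fun=> 2%:R^-1 ^+ 'C(r, 2))) => [|f pf]; last first.
  by rewrite er_half_supersets ?(card_pattern_edges pf) // (pattern_edges_pairs pf).
rewrite sumr_const -[leLHS]mulr_natl -natrX ler_wpM2r ?exprn_ge0 ?invr_ge0 // ler_nat.
have := @card_pattern n r S; rewrite cS; apply: leq_trans.
by rewrite leq_eqVlt; apply/orP; left; apply/eqP; apply: eq_card => f; rewrite inE.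
Qed.

Lemma planted_obstruction n k :
  planted_expectation k (fun G : {set {set 'I_n}} => (obstruction k G)%:R)
  <= (n * k.+1)%:R ^+ k.-1 * 2%:R^-1 ^+ 'C(k.-1, 2) :> R.
Proof.
set B := leRHS.
have B0 : 0 <= B by rewrite mulr_ge0 ?exprn_ge0 ?invr_ge0.
rewrite /planted_expectation; under eq_bigr do rewrite mulr_sumr.
rewrite exchange_big /=.
apply: (@le_trans _ _ (\sum_(S : {set 'I_n} | #|S| == k) 'C(n, k)%:R^-1 * B)).
  apply: ler_sum => S /eqP cS; under eq_bigr do rewrite mulrCA.
  by rewrite -mulr_sumr ler_wpM2l ?invr_ge0 // obstruction_prob.
rewrite sumr_const; set c := #|_|.
have -> : c = 'C(n, k).
  by rewrite -[X in 'C(X, _)]card_ord -card_draws; apply: eq_card => S; rewrite inE.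
(* For k > n there is no planted set and the left side is 0. *)
rewrite -[leLHS]mulr_natl mulrA; have [->|C0] := posnP 'C(n, k); first by rewrite mul0r mul0r.
by rewrite mulfV ?mul1r // pnatr_eq0 -lt0n.
Qed.

End ObstructionProbability.

(** * Cycles of the skeleton *)

Local Open Scope ring_scope.

Section Cycles.
Variables (R : realType) (n k : nat) (G : {set {set 'I_n}}).
Local Notation K := (skel k.-2 (clique_complex G)).
Implicit Types y z : {ffun {set 'I_n} -> R}.

(** The boundary coefficient at the facet [s :\ u] contains [z s] up to sign; for it to vanish, the
    facet needs a second coface in the support. *)
Lemma cycle_neighbour z s u : (2 < k)%N -> is_cycle K k.-2 z -> z s != 0 -> u \in s ->
  exists2 v, v \notin s & clique G (v |: (s :\ u)).
Proof.
move=> k2 [ch bd] zs us; have [/setIdP[]] := ch s zs.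
rewrite inE => /andP[_ /cliqueP cl] _ cs.
set t := s :\ u; have sE : u |: t = s by rewrite setD1K.
have ct : #|t|.+1 = k.-1 by rewrite -add1n -[1%N]/(nat_of_bool true) -us -cardsD1; lia.
(* The empty set is not a face; [2 < k] makes the facet nonempty. *)
have tK : t \in K.
  rewrite !inE -card_gt0; apply/andP; split; last by lia.
  apply/andP; split; first by lia.
  by apply/cliqueP => a b /setD1P[_ sa] /setD1P[_ sb]; apply: cl.
move: (congr1 (fun f : {ffun _ -> R} => f t) bd); rewrite !ffunE tK => sum0.
have [v [vt vu zv]] : exists v, [/\ v \notin t, v != u & z (v |: t) != 0].
  apply: contrapT => no; move: sum0; rewrite (bigD1 u) /=; last by rewrite setD11.
  rewrite big1 => [|v /andP[vt vu]]; last first.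
    have [->|zv] := eqVneq (z (v |: t)) 0; first by rewrite mulr0.
    by case: no; exists v.
  move=> /eqP; rewrite addr0 mulf_eq0 signr_eq0 sE.
  by rewrite (negbTE zs).
exists v; first by apply: contra vt => vs; rewrite !inE vu vs.
by have [/setIdP[]] := ch _ zv; rewrite inE => /andP[_].
Qed.

Lemma cycle_extends z s : (2 < k)%N -> is_cycle K k.-2 z -> ~~ obstruction k G ->
  z s != 0 -> #|s| = k.-1 /\ exists2 v, v \notin s & clique G (v |: s).
Proof.
move=> k2 cyc noobs zs; have [/setIdP[]] := cyc.1 s zs.
rewrite inE => /andP[_ cl] _ cs; have cs' : #|s| = k.-1 by lia.
split=> //; apply: contrapT => noext; case/negP: noobs; apply/existsP; exists s.
rewrite cs' eqxx cl /=; apply/andP; split.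
  by apply/forallP => v; apply/implyP => vs; apply/negP => clv; apply: noext; exists v.
apply/forallP => u; apply/implyP => us; apply/existsP.
by have [v vs clv] := cycle_neighbour k2 cyc zs us; exists v; rewrite vs.
Qed.

Lemma boundary0 : boundary K (0 : {ffun {set 'I_n} -> R}) = 0.
Proof.
apply/ffunP => t; rewrite !ffunE; case: ifP => // _.
by rewrite big1 // => v _; rewrite ffunE mulr0.
Qed.

(* The skeleton has no simplices one dimension up, so only 0 bounds. *)
Lemma is_boundary_skel y : is_boundary K k.-2 y <-> y = 0.
Proof.
split=> [[w chw <-]|->]; last first.
  by exists 0; [move=> s; rewrite ffunE eqxx | apply: boundary0].
suff -> : w = 0 by apply: boundary0.
apply/ffunP => s; rewrite ffunE; apply/eqP; apply: contraT => /chw[/setIdP[_]].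
by move=> le e; rewrite e ltnn in le.
Qed.

Lemma nontrivial_class_skel y :
  (is_cycle K k.-2 y /\ y <> 0) <-> nontrivial_class K k.-2 y.
Proof. by split=> -[cyc nb]; split=> // /is_boundary_skel. Qed.

Lemma l2norm_ge0 y : 0 <= l2norm y.
Proof. exact: sqrtr_ge0. Qed.

Lemma l2norm_sqr y : l2norm y ^+ 2 = \sum_s y s ^+ 2.
Proof. by rewrite sqr_sqrtr // sumr_ge0 // => s _; apply: sqr_ge0. Qed.

(* Pythagoras: chains with disjoint supports are orthogonal. *)
Lemma common_support y z : 1 <= Num.max (l2norm y) (l2norm z) ->
  l2norm (y - z) < 1 -> exists s, y s != 0 /\ z s != 0.
Proof.
move=> big small; apply: contrapT => no.
have : l2norm (y - z) ^+ 2 = l2norm y ^+ 2 + l2norm z ^+ 2.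
  rewrite !l2norm_sqr -big_split; apply: eq_bigr => s _ /=; rewrite !ffunE.
  have [->|ys] := eqVneq (y s) 0; first by ring.
  have [->|zs] := eqVneq (z s) 0; first by ring.
  by case: no; exists s.
have := l2norm_ge0 y; have := l2norm_ge0 z; have := l2norm_ge0 (y - z).
move: big small; rewrite le_max => /orP[]; nra.
Qed.

(** What the reduction needs from an output, common to nonzero cycles and to chains near one. *)
Definition extendable_support y :=
  exists s, [/\ y s != 0, #|s| = k.-1 & exists2 v, v \notin s & clique G (v |: s)].

Lemma cycle_extendable y : (2 < k)%N -> ~~ obstruction k G ->
  is_cycle K k.-2 y -> y <> 0 -> extendable_support y.
Proof.
move=> k2 noobs cyc y0.
have [s ys] : exists s, y s != 0.
  apply: contrapT => no; apply: y0; apply/ffunP => s; rewrite ffunE.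
  by apply/eqP; apply: contraT => ys; case: no; exists s.
by have [cs ext] := cycle_extends k2 cyc noobs ys; exists s.
Qed.

Lemma approx_extendable y : (2 < k)%N -> ~~ obstruction k G ->
  approx_representative K k.-2 (Num.sqrt k%:R)^-1 y -> extendable_support y.
Proof.
move=> k2 noobs [z [/nontrivial_class_skel[cyc z0]]] [->|[_ big small]].
  exact: cycle_extendable.
have [|s [ys zs]] := common_support big; last first.
  by have [cs ext] := cycle_extends k2 cyc noobs zs; exists s.
apply: lt_le_trans small _; rewrite invf_le1 ?sqrtr_gt0 ?ltr0n; last by lia.
by rewrite -[leLHS]sqrtr1 ler_wsqrtr // ler1n; lia.
Qed.

End Cycles.

(** * Asymptotics in the planted-clique window *)

Section Analysis.
Variable R : realType.

Lemma nat_above (x : R) : exists N : nat, x <= N%:R.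
Proof.
exists (Num.bound `|x|); apply: le_trans (ler_norm x) _.
by apply/ltW/archi_boundP.
Qed.

(** This is 1 + t <= e^t at t = ln(ax). A small slope a lets a small multiple of k absorb
    ln(k+1). *)
Lemma ln_le_linear (a x : R) : 0 < a -> 0 < x -> ln x <= a * x - 1 - ln a.
Proof.
move=> a0 x0; have := @expR_ge1Dx R (ln (a * x)).
rewrite lnK ?posrE ?mulr_gt0 // lnM ?posrE //; lra.
Qed.

Lemma window_bounds (eps : R) (k0 : nat) : 0 < eps -> exists N : nat,
  forall n k, (N <= n)%N -> in_window eps n k ->
  [/\ (0 < n)%N, (k0 <= k)%N, (k <= n)%N & (2%:R + eps) * ln n%:R <= k%:R * ln 2%:R :> R].
Proof.
(* For this threshold k >= log_2 n >= k0. *)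
move=> e0; exists (2 ^ k0)%N => n k nN /andP[lo hi].
have n0 : (0 < n)%N by apply: leq_trans nN; rewrite expn_gt0.
have nR : 0 < n%:R :> R by rewrite ltr0n.
have l2 : 0 < ln 2%:R :> R by rewrite ln_gt0 // ltr1n.
have low : (2%:R + eps) * ln n%:R <= k%:R * ln 2%:R.
  by rewrite -ler_pdivrMr // -mulrA.
have lnn : k0%:R * ln 2%:R <= ln n%:R :> R.
  rewrite mulr_natl -lnXn ?ltr0n // -natrX ler_ln ?posrE ?ltr0n ?expn_gt0 // ler_nat.
  exact: nN.
split=> //.
  rewrite -(ler_nat R) -(ler_pM2r l2); apply: le_trans low; apply: le_trans lnn _.
  have : 0 <= ln n%:R :> R by rewrite ln_ge0 // ler1n.
  nra.
rewrite -(ler_nat R); apply: le_trans hi _; rewrite -[leRHS]powRr1 ?ler0n //.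
by rewrite ler_powR ?ler1n //; lra.
Qed.

Lemma bin2_nat r : ('C(r, 2)%:R : R) = r%:R * (r%:R - 1) / 2%:R.
Proof.
case: r => [|r]; first by rewrite bin0n mul0r mul0r.
have := bin2 r.+1; rewrite /= => ->; have := odd_double_half (r.+1 * r).
have -> : odd (r.+1 * r) = false by rewrite oddM /=; case: (odd r).
rewrite add0n -muln2 => e.
rewrite -[r.+1%:R - 1](_ : r%:R = _); last by rewrite -natr1 addrK.
by rewrite -natrM -{2}e natrM mulfK ?pnatr_eq0.
Qed.

Lemma obstruction_bound (eps c : R) : 0 < eps -> 0 < c -> exists N : nat,
  forall n k, (N <= n)%N -> in_window eps n k ->
  (n * k.+1)%:R ^+ k.-1 * 2%:R^-1 ^+ 'C(k.-1, 2) <= n%:R `^ (- c) :> R.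
Proof.
move=> e0 c0; set l2 : R := ln 2%:R.
have l20 : 0 < l2 by rewrite ln_gt0 // ltr1n.
(* Since 1/(2+eps) = 1/2 - delta, the window gives ln n <= (1/2 - delta) k ln 2. *)
pose delta : R := eps / (2%:R * (2%:R + eps)).
have d0 : 0 < delta by rewrite divr_gt0 // mulr_gt0 //; lra.
have dE : delta * (2%:R * (2%:R + eps)) = eps by rewrite divfK // mulf_neq0 //; lra.
(* With this slope ln(k+1) + ln 2 <= 2ak spends only half of the gain delta k ln 2. *)
pose a := delta * l2 / 4%:R.
have a0 : 0 < a by rewrite divr_gt0 // mulr_gt0.
have aE : 4%:R * a = delta * l2 by rewrite mulrC divfK // pnatr_eq0.
(* From [k1] on, ak absorbs the constants of the linear bound; from [k2] on, the product of k - 1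
   factors n^(-delta) is at most n^(-c). *)
have [k1 k1P] := nat_above ((a - 1 - ln a + l2) / a).
have [k2 k2P] := nat_above (c / delta + 1).
have [N NP] := window_bounds (maxn 3 (maxn k1 k2)) e0; exists N => n k nN win.
have [n0 kk kn low] := NP n k nN win.
have k3 : (3 <= k)%N by apply: leq_trans kk; rewrite leq_maxl.
have kk1 : (k1 <= k)%N by apply: leq_trans kk; rewrite !leq_max leqnn !orbT.
have kk2 : (k2 <= k)%N by apply: leq_trans kk; rewrite !leq_max leqnn !orbT.
have nR : 0 < n%:R :> R by rewrite ltr0n.
have kR : 0 < k.+1%:R :> R by rewrite ltr0n.
have nk : 0 < (n * k.+1)%:R :> R by rewrite natrM mulr_gt0.
rewrite -ler_ln ?posrE ?mulr_gt0 ?exprn_gt0 ?invr_gt0 ?powR_gt0 //.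
rewrite lnM ?posrE ?exprn_gt0 ?invr_gt0 // !lnXn ?invr_gt0 // lnV ?posrE // natrM lnM ?posrE //.
rewrite ln_powR -[_ *+ k.-1]mulr_natl -[_ *+ 'C(_, _)]mulr_natl -/l2 bin2_nat.
have k1R : k.-1%:R = k%:R - 1 :> R by rewrite -subn1 natrB // (ltnW (ltnW k3)).
have lk := ln_le_linear a0 kR; rewrite -natr1 in lk.
have h1 : (a - 1 - ln a + l2) <= a * k%:R.
  rewrite mulrC -ler_pdivrMr //; apply: le_trans k1P _; by rewrite ler_nat.
have h2 : c <= delta * (k%:R - 1).
  by rewrite mulrC -ler_pdivrMr // lerBrDr; apply: le_trans k2P _; rewrite ler_nat.
have ln0 : 0 <= ln n%:R :> R by rewrite ln_ge0 // ler1n.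
have k3R : 3%:R <= k%:R :> R by rewrite ler_nat.
rewrite k1R -natr1; set x := k%:R in lk h1 h2 low k3R *; set ln_n := ln n%:R in low ln0 *.
set lk1 := ln (x + 1) in lk *.
(* each of the k - 1 factors is at most n^(-delta) *)
have factor : ln_n + lk1 - (x - 2%:R) / 2%:R * l2 <= - (delta * ln_n).
  have b1 : lk1 + l2 <= 2%:R * a * x by lra.
  have b2 : ln_n - x / 2%:R * l2 <= - (2%:R * delta) * (x * l2) / 2%:R.
    have : (2%:R + eps) * (ln_n - x / 2%:R * l2 + delta * (x * l2)) <= 0.
      rewrite [leLHS](_ : _ = (2%:R + eps) * ln_n - (2%:R + eps) / 2%:R * (x * l2) +
        (2%:R + eps) * delta * (x * l2)); last by field.
      have -> : (2%:R + eps) * delta = eps / 2%:R by lra.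
      rewrite [leLHS](_ : _ = (2%:R + eps) * ln_n - x * l2); last by field.
      by rewrite subr_le0.
    rewrite pmulr_rle0; [lra|lra].
  have b3 : 2%:R * ln_n <= x * l2 by apply: le_trans low; rewrite ler_wpM2r; lra.
  have b4 : delta * (2%:R * ln_n) <= delta * (x * l2) by rewrite ler_wpM2l // ltW.
  have b5 : 4%:R * a * x = delta * (x * l2) by rewrite aE; ring.
  lra.
apply: (@le_trans _ _ ((x - 1) * - (delta * ln_n))).
  rewrite [leLHS](_ : _ = (x - 1) * (ln_n + lk1 - (x - 2%:R) / 2%:R * l2)); last by field.
  by rewrite ler_wpM2l //; lra.
have : c * ln_n <= delta * (x - 1) * ln_n by rewrite ler_wpM2r.
lra.
Qed.

End Analysis.

(** * Reduction to clique search *)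

Section Reduction.
Variables (R : realType) (m : model) (coef : nat -> R).

Lemma plant_pairs n (E S : {set _}) : E \subset pairs n -> plant E S \subset pairs n.
Proof. by move=> Ep; rewrite subUset Ep; apply/subsetP => e; rewrite inE => /andP[]. Qed.

Lemma er_pmf_ge0 n (E : {set {set 'I_n}}) : 0 <= er_pmf (2%:R^-1) E :> R.
Proof. by rewrite er_pmf_half exprn_ge0 ?invr_ge0. Qed.

(** Without an obstruction each success of p yields a clique to the search; with one, success has
    probability at most 1. So the success of p is at most that of the search plus the probability of
    an obstruction. *)
Lemma hard_of_extendable_support
    (ev : forall n, nat -> {set {set 'I_n}} -> {ffun {set 'I_n} -> R} -> Prop) :
  strong_search_conjecture R m ->
  (forall n k (G : {set {set 'I_n}}) y, (2 < k)%N -> ~~ obstruction k G ->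
     ev n k G y -> extendable_support k G y) ->
  hard_on_average m coef ev.
Proof.
move=> conj evP eps c e0 c0 p d eff.
(* The conjecture wants alpha < 1/2; alpha <= eps makes its bound on k follow from the window. *)
pose alpha : R := Num.min eps 4%:R^-1.
have alphaP : 0 < alpha < 2%:R^-1.
  by rewrite lt_min gt_min e0 invr_gt0 ltr0n /= ltf_pV2 ?posrE ?ltr0n // ltr_nat orbT.
(* Two terms n^(-c-1) add up to (2/n) n^(-c), strictly below n^(-c) for n at least 3. *)
have c1 : 0 < c + 1 by lra.
have [N1 N1P] := conj eps alpha (c + 1) e0 alphaP c1 _ _ (efficient_search eff).
have [N2 N2P] := obstruction_bound e0 c1.
have [N3 N3P] := window_bounds 3 e0.
exists (maxn 3 (maxn N1 (maxn N2 N3))) => n k; rewrite !geq_max => /and4P[n3 nN1 nN2 nN3] win.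
have [n0 k3 kn _] := N3P n k nN3 win.
have nR : 1 <= n%:R :> R by rewrite ler1n.
have kalpha : k%:R <= n%:R `^ (2%:R^-1 - alpha).
  have /andP[_ hi] := win; apply: le_trans hi _.
  by rewrite ler_powR // lerB // ge_min lexx.
have bound1 := N1P n k nN1 win kalpha.
have bound2 := le_trans (planted_obstruction R n k) (N2P n k nN2 win).
apply: (@le_lt_trans _ _ (success_prob R (Seq p extract_clique) (search_exponent d) k
    (@clique_found n k) +
    planted_expectation k (fun G : {set {set 'I_n}} => (obstruction k G)%:R))).
  rewrite /success_prob /planted_expectation -big_split /=; apply: ler_sum => E.
  rewrite inE => Ep; rewrite -mulrDr ler_wpM2l ?er_pmf_ge0 // -big_split /=.
  apply: ler_sum => S _; rewrite -mulrDr ler_wpM2l ?invr_ge0 //.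
  set G := plant E S; have Gp : G \subset pairs n by apply: plant_pairs.
  case: (boolP (obstruction k G)) => [_|noobs].
    by rewrite ler_wpDl ?prob_le1 // sumr_ge0 // => ? _; apply: normsq_ge0.
  rewrite addr0; apply: le_trans (prob_search R p d kn Gp).
  apply: prob_mono => w /asboolP /(evP _ _ _ _ k3 noobs)[s [ys cs [v vs cl]]].
  exact: support_block (ltnW (ltnW k3)) cs vs cl ys.
apply: le_lt_trans (lerD bound1 bound2) _.
rewrite opprD powRD; last by rewrite pnatr_eq0 -lt0n n0 implybT.
rewrite powR_inv1 ?ler0n // -mulrDr -[ltRHS]mulr1 ltr_pM2l ?powR_gt0 ?ltr0n //.
by rewrite -mulr2n -[ltLHS]mulr_natl ltr_pdivrMr ?ltr0n // mul1r ltr_nat.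
Qed.

End Reduction.

Theorem corollary6 (R : realType) (m : model) (coef : nat -> R) :
  strong_search_conjecture R m ->
  [/\ hard_on_average m coef (fun n k G y =>
        is_cycle (skel k.-2 (clique_complex G)) k.-2 y /\ y <> 0),
      (forall n k (G : {set {set 'I_n}}) (y : {ffun {set 'I_n} -> R}),
        (is_cycle (skel k.-2 (clique_complex G)) k.-2 y /\ y <> 0) <->
        nontrivial_class (skel k.-2 (clique_complex G)) k.-2 y),
      hard_on_average m coef (fun n k G y =>
        approx_representative (skel k.-2 (clique_complex G)) k.-2
          (Num.sqrt k%:R)^-1 y) &
      hard_on_average m coef (fun n k G y =>
        nontrivial_class (skel k.-2 (clique_complex G)) k.-2 y /\
        minimal_weight (skel k.-2 (clique_complex G)) k.-2 y)].
Proof.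
move=> conj; split.
- apply: hard_of_extendable_support conj _ => n k G y k2 noobs [cyc y0].
  exact: cycle_extendable cyc y0.
- by move=> n k G y; apply: nontrivial_class_skel.
- apply: hard_of_extendable_support conj _ => n k G y.
  exact: approx_extendable.
- apply: hard_of_extendable_support conj _ => n k G y k2 noobs [nt _].
  have [cyc y0] := (nontrivial_class_skel k G y).2 nt.
  exact: cycle_extendable cyc y0.
Qed.
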